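(* Let $X$ be a smooth Calabi--Yau threefold, let $\sigma$ be a large radius limit point of $K_{\mathbb C}(X)$ generated by a basis $T_1,\dots,T_n$ of $H^2(X,\mathbb Z)/\text{torsion}$ contained in $\overline{K(X)}$, and let $$\partial X_{-1}=\sum_{j=1}^n\Big(N_j+\frac{\partial\Gamma_{-1}}{\partial u_j}\Big)\otimes du_j$$ be the Higgs field of the corresponding A-model variation $\mathcal V$. Then for any element $\alpha\in H=\bigoplus_pH^{p,p}(X)$ and every $j$: $$\partial X_{-1}\Big(\frac{\partial}{\partial u_j}\Big)\alpha=T_j\ast\alpha .$$
   Context: $K(X)\subset H^2(X,\mathbb R)$ is the Kähler cone, and $K_{\mathbb C}(X)$ is the quotient of $\{\omega\in H^2(X,\mathbb C):\mathrm{Im}\,\omega\in K(X)\}$ by the torsion-free part of $H^2(X,\mathbb Z)$. A simplicial cone $\sigma\subset H^2(X,\mathbb R)$ is a large radius limit point if it is of maximal dimension and $Int(\sigma)\subseteq K(X)$. Write $\omega=\sum_ju_jT_j$ with $\mathrm{Im}\,u_j>0$, $q_j=e^{2\pi iu_j}$; these identify a neighborhood of infinity $D_\sigma$ of $K_{\mathbb C}(X)$ with $\Delta^{*n}$, with completion $\overline D_\sigma\cong\Delta^n$. Let $T_0=1\in H^0(X)$ and let ${}^\vee:H^k(X,\mathbb C)\to H^{6-k}(X,\mathbb C)$ denote Poincaré duality on the basis, so $\{T_\ell^\vee\}_{\ell=1}^n$ is the basis of $H^4(X,\mathbb C)$ dual to $\{T_\ell\}$ and $T_0^\vee\in H^6(X)$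 is dual to $T_0$. The Gromov--Witten potential is $$\Phi=\frac16\int_X\omega^3+\Phi_{hol}(q),\qquad\Phi_{hol}(q)=\frac1{(2\pi i)^3}\sum_{\beta\in H_2(X,\mathbb Z)-\{0\}}\langle I_{0,0,\beta}\rangle e^{2\pi i\int_\beta\omega},$$ $\langle I_{0,0,\beta}\rangle$ being the genus zero, zero-point Gromov--Witten invariants; the series is assumed to converge on $\overline D_\sigma$. The small quantum product on $H$ is $T_j\ast T_k=\sum_{\ell=1}^n\frac{\partial^3\Phi}{\partial u_j\partial u_k\partial u_\ell}T_\ell^\vee$ for $1\le j,k\le n$, and it coincides with cup product unless both factors lie in $H^2$. A-model variation: $\mathcal V=H\times D_\sigma$ with the flat Dubrovin connection $\nabla=d+A$, $A_{\partial/\partial u_j}\alpha=T_j\ast\alpha$; Hodge filtration $\mathcal F^p=\bigoplus_{a\le3-p}H^{a,a}(X)$; polarization $Q(\alpha,\beta)=(-1)^p\int_X\alpha\wedge\beta$ for $\alpha\in H^{p,p}$, $\beta\in H^{3-p,3-p}$. The canonical extension is $\mathcal V^c=H\times\overline D_\sigma$, $\nabla^c=\nabla-\frac1{2\pi i}\sum_j\frac{dq_j}{q_j}\otimes N_j$ with $N_j=-\log$ of the monodromy about $q_j=0$; the integral flat sections of $\mathcal V$ are $e^{-\sum\frac1{2\pi i}\log(q_j)N_j}\sigma^c$ with $\sigma^c$ a $\nabla^c$-flat section with $\sigma^c(0)\in H^*(X,\mathbb Z)$. This is a variation of pure polarized Hodge structure of weight 3 near $q=0$, $N_j$ acts on the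 central fiber $H$ of $\mathcal V^c$ as cup product with $T_j$, and the limiting mixed Hodge structure $(F_\infty,W)$ on $H$ has Deligne bigrading $I^{p,p}=H^{3-p,3-p}(X)$ (other $I^{p,q}=0$). Let $\psi(q)$ be the filtration of $H$ obtained from $\mathcal F_q$ by $\nabla^c$-parallel translation to the central fiber, $F_\infty=\psi(0)$. Then near $0$, $\psi(q)=e^{\Gamma(q)}.F_\infty$ with unique holomorphic $\Gamma$, $\Gamma(0)=0$, $\Gamma=\Gamma_{-1}+\Gamma_{-2}+\Gamma_{-3}$, where $\Gamma_{-k}(q)$ is an infinitesimal isometry of $Q$ mapping $I^{p,p}$ to $I^{p-k,p-k}$, i.e. $H^{a,a}$ to $H^{a+k,a+k}$. *)

(* Defs.v *)
From HB Require Import structures.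
From mathcomp Require Import all_boot all_order all_algebra all_field.
From mathcomp Require Import all_classical all_reals all_analysis.
From mathcomp Require Import complex.
From mathcomp.analysis.showcase Require summability.

Set Implicit Arguments.
Unset Strict Implicit.
Unset Printing Implicit Defensive.

Import Order.TTheory GRing.Theory Num.Theory.
Import numFieldNormedType.Exports.

Local Open Scope classical_set_scope.
Local Open Scope ring_scope.

(* The complex numbers over [R]. The type annotation matters: the topology of
   [numFieldNormedType] is only found on a term of type [numClosedFieldType]. *)
Definition cplx (R : realType) : numClosedFieldType := R[i]%C.

Definition ofR (R : realType) (x : R) : cplx R := Complex x 0.
Definition cRe (R : realType) (z : cplx R) : R := complex.Re z.
Definition cIm (R : realType) (z : cplx R) : R := complex.Im z.

Definition cexp (R : realType) (z : cplx R) : cplx R :=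
  ofR (expR (cRe z)) * Complex (cos (cIm z)) (sin (cIm z)).

Definition twopii (R : realType) : cplx R := Complex 0 (2 * pi).

Definition is_intC (R : realType) (z : cplx R) : Prop :=
  exists m : int, z = m%:~R.

(** * Calculus for maps into a finite-dimensional complex vector space *)

Section Calculus.
Variables (R : realType) (n : nat) (V : vectType (cplx R)).
Implicit Types (f : 'rV[cplx R]_n -> V) (A : set 'rV[cplx R]_n).

Definition holomorphic_on A f : Prop :=
  forall u, A u -> differentiable (fun x => passmx.rVof (vbasis {:V}) (f x)) u.

Definition partial f (j : 'I_n) (u : 'rV[cplx R]_n) : V :=
  passmx.vecof (vbasis {:V})
    ('D_(delta_mx 0 j) (fun x => passmx.rVof (vbasis {:V}) (f x)) u).

(* Exponential of a nilpotent linear map: the terms of index at least \dim V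
   vanish. *)
Definition nexp (f : V -> V) (v : V) : V :=
  \sum_(k < (\dim {:V}).+1) (k`!%:R : cplx R)^-1 *: iter k f v.

Definition nilpotent (f : V -> V) : Prop :=
  exists k : nat, forall v, iter k f v = 0.

End Calculus.

(** * Cohomology of a Calabi-Yau threefold *)

(* The ring H = H^{0,0} + H^{1,1} + H^{2,2} + H^{3,3} under cup product, the
   integration map, and the image of integral cohomology.  As
   h^{1,0} = h^{2,0} = 0, one has H^{2p}(X, C) = H^{p,p}(X). *)
Record hodge_ring (R : realType) := HodgeRing {
  coh :> falgType (cplx R);
  hodge : nat -> {vspace coh};
  cohZ : set coh;
  integral_X : {scalar coh};

  cup_comm : commutative (fun a b : coh => a * b);
  hodge_direct : directv (\sum_(p < 4) hodge p)%VS;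
  hodge_full : (\sum_(p < 4) hodge p)%VS = fullv;
  hodge_gt3 : forall p, (3 < p)%N -> hodge p = 0%VS;
  hodge_cup : forall p q a b,
    a \in hodge p -> b \in hodge q -> a * b \in hodge (p + q)%N;
  hodge_0 : hodge 0%N = <[1]>%VS;

  integral_lt3 : forall p a, (p < 3)%N -> a \in hodge p -> integral_X a = 0;
  poincare_duality : forall a, (forall b, integral_X (a * b) = 0) -> a = 0;

  cohZ_1 : cohZ 1;
  cohZ_cup : forall a b, cohZ a -> cohZ b -> cohZ (a * b);
  cohZ_lattice : exists b : (\dim {:coh}).-tuple coh,
    basis_of fullv b /\
    forall a, cohZ a <-> exists m : 'I_(\dim {:coh}) -> int,
      a = \sum_i (m i)%:~R *: tnth b i;
  cohZ_graded : forall p a,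
    cohZ a -> cohZ (sumv_pi (\sum_(p < 4) hodge p)%VS p a);
  cohZ_poincare : forall a,
    cohZ a <-> (forall b, cohZ b -> is_intC (integral_X (a * b)))
}.

Section HodgeRing.
Variables (R : realType) (H : hodge_ring R).

Definition hproj (p : 'I_4) : 'End(H) :=
  sumv_pi (\sum_(p < 4) hodge H p)%VS p.

(* [T] is a Z-basis of H^2(X, Z)/torsion. *)
Definition is_H2Z_basis n (T : n.-tuple H) : Prop :=
  basis_of (hodge H 1) T /\
  forall a, a \in hodge H 1 ->
    (cohZ a <-> exists m : 'I_n -> int, a = \sum_j (m j)%:~R *: tnth T j).

(* H^2(X, R) *)
Definition in_H2R (a : H) : Prop :=
  exists m (x : 'I_m -> R) (b : 'I_m -> H),
    (forall i, b i \in hodge H 1 /\ cohZ (b i)) /\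
    a = \sum_i ofR (x i) *: b i.

(* The subset [A] of H^2(X, R) read in the coordinates of the basis [T]. *)
Definition in_coords n (T : n.-tuple H) (A : set H) : set 'rV[R]_n :=
  [set x | A (\sum_j ofR (x 0 j) *: tnth T j)].

(* [D l] is the element T_l^vee of H^4 dual to T_l. *)
Definition is_dual_basis n (T D : n.-tuple H) : Prop :=
  forall l, tnth D l \in hodge H 2 /\
    forall k, integral_X H (tnth T k * tnth D l) = (k == l)%:R.

Definition hodge_filtration (p : nat) : {vspace H} :=
  (\sum_(a < 4 | (a + p <= 3)%N) hodge H a)%VS.

Definition polarization (a b : H) : cplx R :=
  \sum_(p < 4) (-1) ^+ p * integral_X H (hproj p a * hproj (rev_ord p) b).

Definition infinitesimal_isometry (f : 'End(H)) : Prop :=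
  forall a b, polarization (f a) b + polarization a (f b) = 0.

(* The component of [f] mapping H^{a,a} to H^{a+k,a+k} for all a; in terms of
   the bigrading I^{p,p} = H^{3-p,3-p} it has degree -k. *)
Definition degree_comp (k : nat) (f : 'End(H)) : 'End(H) :=
  \sum_(a < 4) \sum_(b < 4 | ((b : nat) == (a : nat) + k)%N)
    (hproj b \o f \o hproj a)%VF.

End HodgeRing.

Record cy3 (R : realType) := CY3 {
  ring_of :> hodge_ring R;

  (* H_2(X, Z), possibly with torsion, and the pairing int_beta alpha *)
  curves : zmodType;
  period : curves -> {scalar ring_of};
  period_add : forall b c a, period (b + c) a = period b a + period c a;
  period_off : forall p b a, p != 1%N -> a \in hodge ring_of p ->
    period b a = 0;
  period_int : forall a, a \in hodge ring_of 1 ->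
    (cohZ a <-> forall b, is_intC (period b a));
  curves_fg : exists s : seq curves, forall b,
    exists m : 'I_(size s) -> int, b = \sum_(i < size s) s`_i *~ m i;
  curves_torsion : forall b, (forall a, period b a = 0) ->
    exists2 m, (0 < m)%N & b *+ m = 0;

  kahler : set ring_of;
  kahler_real : forall a, kahler a -> a \in hodge ring_of 1 /\ in_H2R a;
  kahler_nonempty : kahler !=set0;
  kahler_add : forall a b, kahler a -> kahler b -> kahler (a + b);
  kahler_scale : forall (t : R) a, 0 < t -> kahler a -> kahler (ofR t *: a);
  kahler_open : forall n (T : n.-tuple ring_of),
    is_H2Z_basis T -> open (in_coords T kahler);
  kahler_volume : forall a, kahler a -> 0 < integral_X ring_of (a ^+ 3);

  (* The invariants <I_{0,0,beta}>; they vanish unless beta is the class of an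
     effective curve, on which Kahler classes are positive. *)
  gw : curves -> rat;
  gw_effective : forall b a, b != 0 -> gw b != 0 -> kahler a ->
    0 < period b a
}.

(* The T_j generate a simplicial cone of maximal dimension in H^2(X, R), with
   interior in the Kahler cone, and lie in the closure of the Kahler cone. *)
Definition large_radius_limit (R : realType) (X : cy3 R) n
    (T : n.-tuple X) : Prop :=
  [/\ is_H2Z_basis T,
      [set x : 'rV[R]_n | forall j, 0 <= x 0 j]° `<=`
        in_coords T (@kahler R X)
    & forall j, closure (in_coords T (@kahler R X)) (delta_mx 0 j)].

(** * The A-model variation *)

Section AModel.
Variables (R : realType) (X : cy3 R) (n : nat).
Variables (T D : n.-tuple X).
Local Notation C := (cplx R).
Local Notation H := (coh X).
Implicit Types (u q : 'rV[C]_n) (a b : H).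

(* The coordinates u on the universal cover of D_sigma; functions on D_sigma
   are functions of u invariant under u_j |-> u_j + 1. *)
Definition upper_half : set 'rV[C]_n := [set u | forall j, 0 < cIm (u 0 j)].

(* The completion Delta^n of D_sigma, with coordinates q. *)
Definition polydisc : set 'rV[C]_n := [set q | forall j, `|q 0 j| < 1].

Definition qmap u : 'rV[C]_n := \row_j cexp (twopii R * u 0 j).

Definition omega u : H := \sum_j u 0 j *: tnth T j.

Definition gw_term u (b : curves X) : C :=
  if b == 0 then 0 else ratr (gw b) * cexp (twopii R * period b (omega u)).

(* Absolute convergence over D_sigma.  It is equivalent to convergence of the
   power series in q on the whole of Delta^n, since the exponents
   int_beta T_j of q_j are nonnegative when gw beta != 0. *)
Definition gw_convergent : Prop :=
  forall u, upper_half u ->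
    summable [set: curves X] (fun b : curves X => (cRe `|gw_term u b|)%:E).

Definition Phi_hol u : C :=
  (twopii R ^+ 3)^-1 * summability.sum (gw_term u : curves X -> C).

Definition Phi u : C := 6%:R^-1 * integral_X X (omega u ^+ 3) + Phi_hol u.

Definition dPhi3 (j k l : 'I_n) u : C :=
  'D_(delta_mx 0 j) (fun u1 : 'rV[C]_n =>
    'D_(delta_mx 0 k) (fun u2 : 'rV[C]_n =>
      'D_(delta_mx 0 l) Phi u2) u1) u.

(* Small quantum product at u.  The H^2 components of a and b are multiplied
   by the bilinear extension of T_j * T_k = sum_l Phi_jkl T_l^vee; all other
   products of homogeneous components are cup products. *)
Definition qprod u a b : H :=
  let a2 := hproj X (inord 1) a in
  let b2 := hproj X (inord 1) b in
  (a * b - a2 * b2) +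
  \sum_j \sum_k (coord T j a2 * coord T k b2) *:
    \sum_l dPhi3 j k l u *: tnth D l.

(* Multivalued flat sections of V = H x D_sigma for the Dubrovin connection
   nabla = d + A, A_{d/du_j} a = T_j * a. *)
Definition dubrovin_flat (s : 'rV[C]_n -> H) : Prop :=
  holomorphic_on upper_half s /\
  forall u j, upper_half u -> partial s j u + qprod u (tnth T j) (s u) = 0.

(* The loop about q_j = 0 lifts to the path from u to u + e_j, so
   continuation of flat sections along it gives the monodromy exp (- N_j).
   [N j q] is the value at q of the section N_j of End(V^c) = End(H) x Delta^n;
   its action on the central fiber of V^c is [N j 0]. *)
Definition is_monodromy_log (N : 'I_n -> 'rV[C]_n -> 'End(H)) : Prop :=
  forall j,
    holomorphic_on polydisc (N j) /\
    forall u, upper_half u ->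
      nilpotent (N j (qmap u)) /\
      forall s, dubrovin_flat s ->
        s (u + delta_mx 0 j) = nexp (- N j (qmap u) : 'End(H)) (s u).

Section CanonicalExtension.
Variable N : 'I_n -> 'rV[C]_n -> 'End(H).

(* Flat sections of V^c = H x Delta^n for
   nabla^c = nabla - (2 pi i)^-1 sum_j dq_j / q_j (x) N_j;
   note that (2 pi i)^-1 dq_j / q_j = du_j. *)
Definition canonical_flat (s : 'rV[C]_n -> H) : Prop :=
  holomorphic_on polydisc s /\
  forall u j, upper_half u ->
    partial (fun u' => s (qmap u')) j u + qprod u (tnth T j) (s (qmap u))
      - N j (qmap u) (s (qmap u)) = 0.

(* The p-th step of psi(q): the nabla^c-parallel translation of F^p_q to the
   central fiber. *)
Definition psi (p : nat) q : set H :=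
  [set v | exists s, [/\ canonical_flat s, s q \in hodge_filtration X p
                       & s 0 = v]].

(* The limiting filtration psi 0 is identified with the filtration
   [hodge_filtration X] of the central fiber H: parallel translation from 0 to
   0 is the identity, and F_infty^p is the sum of the I^{r,r} = H^{3-r,3-r}
   with r >= p. *)
Definition is_Gamma (U : set 'rV[C]_n) (G : 'rV[C]_n -> 'End(H)) : Prop :=
  [/\ holomorphic_on U G, G 0 = 0 &
   forall q, U q ->
   [/\ G q = \sum_(1 <= k < 4) degree_comp k (G q),
       forall k, (1 <= k <= 3)%N ->
         infinitesimal_isometry (degree_comp k (G q))
     & forall p, (p <= 3)%N ->
         psi p q = nexp (G q) @` [set v | v \in hodge_filtration X p]]].

(* The End(H)-valued 1-form sum_j (N_j + dGamma_{-1}/du_j) (x) du_j, at u and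
   evaluated on the tangent vector sum_j v_j d/du_j. *)
Definition higgs_field (G : 'rV[C]_n -> 'End(H)) u (v : 'rV[C]_n) : 'End(H) :=
  \sum_j v 0 j *:
    (N j 0 + partial (fun u' => degree_comp 1 (G (qmap u'))) j u).

End CanonicalExtension.
End AModel.

(* Main.v *)
Require Import Defs.
From HB Require Import structures.
From mathcomp Require Import all_boot all_order all_algebra all_field.
From mathcomp Require Import all_classical all_reals all_analysis.
From mathcomp Require Import complex ring lra finmap.
From mathcomp.analysis.showcase Require summability.

(** The Dubrovin connection of a Calabi-Yau threefold can be integrated in closed
    form, and the theorem follows by reading off each object from the solution.

    Let [h] be the holomorphic part of the Gromov-Witten potential and [h_k],
    [h_kl], [h_jkl] its partial derivatives in the coordinates [u]. They are
    absolutely convergent series of exponentials, invariant under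
    [u_j |-> u_j + 1] and tending to [0] at the large radius limit, and the third
    derivatives of the potential are the triple intersection numbers plus
    [h_jkl]. Hence quantum and cup product with [T_j] differ only by the map
    sending [T_k] to [sum_l h_jkl T_l^vee].

    Let [K = 1 + corr], where [corr] sends [1] to
    [- sum_l h_l T_l^vee + 2 h pt], [T_k] to [- sum_l h_kl T_l^vee + h_k pt] and
    the rest to [0]. Then [corr^2 = 0] and, in coordinates,
    [d_j K + T_j * K - K (T_j cup) = 0]. Consequently [K exp (- omega) b] is flat
    for every [b] ([flat_section_flat]). As [K] is periodic, the monodromy about
    [q_j = 0] is [K exp (- T_j) K^-1]; a nilpotent endomorphism is determined by
    its exponential ([nexp_inj]), so [N_j = K (T_j cup) K^-1]
    ([monodromy_log_eq]), and [K -> 1] shows that [N_j] is the cup product with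
    [T_j] at [q = 0] ([monodromy_log0]).

    If [s] is flat for the canonical extension, the same equation for [K] shows
    that [K^-1 s] is constant, with value [s 0] ([canonical_flat_fundK]). So
    [K] maps [psi] into the Hodge filtration, and [K exp (Gamma)] preserves that
    filtration. It is also unipotent for the
    filtration by cohomological degree, which is opposite, and is therefore the
    identity ([nexp_Gamma]): [exp (Gamma) = 1 - corr]. In degree one,
    [Gamma_{-1}] sends [T_k] to [sum_l h_kl T_l^vee] ([Gamma1E]). Its derivative
    with respect to [u_j] has entries [h_jkl], and adding the cup product [N_j]
    gives the quantum product with [T_j] ([higgs_fieldE]). *)

Set Implicit Arguments.
Unset Strict Implicit.
Unset Printing Implicit Defensive.

Import Order.TTheory GRing.Theory Num.Theory.
Import numFieldNormedType.Exports.

Local Open Scope classical_set_scope.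
Local Open Scope ring_scope.

(** * Real-valued norms of complex vectors *)

Section RealNorm.
Context {R : realType}.
Local Notation C := (cplx R).

(** A norm over the complex numbers is itself a complex number; taking its
    real part moves estimates to a totally ordered field. *)
Definition nm {V : normedModType C} (v : V) : R := cRe `|v|.

Lemma ofR_le (x y : R) : (ofR x <= ofR y) = (x <= y).
Proof. exact: lecR. Qed.

Lemma ofR_lt (x y : R) : (ofR x < ofR y) = (x < y).
Proof. exact: ltcR. Qed.

Lemma ofRD (x y : R) : ofR (x + y) = ofR x + ofR y.
Proof. exact: (rmorphD (real_complex R)). Qed.

Lemma ofRM (x y : R) : ofR (x * y) = ofR x * ofR y.
Proof. exact: (rmorphM (real_complex R)). Qed.

Lemma ofR_inj : injective (@ofR R).
Proof. exact: complexI. Qed.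

Lemma ofR0 : ofR (0 : R) = 0. Proof. by []. Qed.
Lemma ofR1 : ofR (1 : R) = 1. Proof. by []. Qed.

Lemma ofRB (x y : R) : ofR (x - y) = ofR x - ofR y.
Proof. exact: (rmorphB (real_complex R)). Qed.

Lemma ofR_sum (I : Type) (r : seq I) (P : pred I) (f : I -> R) :
  ofR (\sum_(i <- r | P i) f i) = \sum_(i <- r | P i) ofR (f i).
Proof. exact: (rmorph_sum (real_complex R)). Qed.

Lemma ofR_cRe (z : C) : cIm z = 0 -> ofR (cRe z) = z.
Proof. by case: z => x y /= ->. Qed.

Lemma ge0_ofR_cRe (z : C) : 0 <= z -> ofR (cRe z) = z.
Proof. by move=> /ger0_Im; exact: ofR_cRe. Qed.

Lemma nmE (V : normedModType C) (v : V) : ofR (nm v) = `|v|.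
Proof. exact/ge0_ofR_cRe. Qed.

Lemma nm_ge0 (V : normedModType C) (v : V) : 0 <= nm v.
Proof. by rewrite -ofR_le nmE ofR0. Qed.

Lemma nm0 (V : normedModType C) : nm (0 : V) = 0.
Proof. by rewrite /nm normr0. Qed.

Lemma nmD (V : normedModType C) (v w : V) : nm (v + w) <= nm v + nm w.
Proof. by rewrite -ofR_le ofRD !nmE ler_normD. Qed.

Lemma nmB (V : normedModType C) (v w : V) : nm (v - w) = nm (w - v).
Proof. by rewrite /nm distrC. Qed.

Lemma nmZ (V : normedModType C) (a : C) (v : V) : nm (a *: v) = nm a * nm v.
Proof. by apply: ofR_inj; rewrite ofRM !nmE normrZ. Qed.

Lemma nmM (a b : C) : nm (a * b) = nm a * nm b.
Proof. by apply: ofR_inj; rewrite ofRM !nmE normrM. Qed.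

Lemma nm_sum (V : normedModType C) (I : Type) (r : seq I) (P : pred I) (f : I -> V) :
  nm (\sum_(i <- r | P i) f i) <= \sum_(i <- r | P i) nm (f i).
Proof.
elim/big_rec2 : _ => [|i y x _ h]; first by rewrite nm0.
by apply: (le_trans (nmD _ _)); rewrite lerD2l.
Qed.

Lemma nm_complex (x y : R) : nm (Complex x y : C) = Num.sqrt (x ^+ 2 + y ^+ 2).
Proof. by have /(congr1 (@cRe R)) := normc_def (Complex x y). Qed.

Lemma nm_ofR (x : R) : nm (ofR x : C) = `|x|.
Proof. by rewrite /ofR nm_complex expr0n /= addr0 sqrtr_sqr. Qed.

Lemma cRe_nm (z : C) : `|cRe z| <= nm z.
Proof.
case: z => x y; rewrite nm_complex /= -sqrtr_sqr ler_wsqrtr//.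
by rewrite lerDl sqr_ge0.
Qed.

Lemma cIm_nm (z : C) : `|cIm z| <= nm z.
Proof.
case: z => x y; rewrite nm_complex /= -sqrtr_sqr ler_wsqrtr//.
by rewrite lerDr sqr_ge0.
Qed.

Lemma cReD (z w : C) : cRe (z + w) = cRe z + cRe w.
Proof. by case: z; case: w. Qed.
Lemma cImD (z w : C) : cIm (z + w) = cIm z + cIm w.
Proof. by case: z; case: w. Qed.
Lemma cReN (z : C) : cRe (- z) = - cRe z.
Proof. by case: z. Qed.
Lemma cImN (z : C) : cIm (- z) = - cIm z.
Proof. by case: z. Qed.
Lemma cReM (z w : C) : cRe (z * w) = cRe z * cRe w - cIm z * cIm w.
Proof. by case: z; case: w. Qed.
Lemma cImM (z w : C) : cIm (z * w) = cRe z * cIm w + cIm z * cRe w.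
Proof. by case: z => a b; case: w => c d /=; rewrite [b * c]mulrC. Qed.

Lemma cRe_sum (I : Type) (r : seq I) (P : pred I) (f : I -> C) :
  cRe (\sum_(i <- r | P i) f i) = \sum_(i <- r | P i) cRe (f i).
Proof. by elim/big_rec2 : _ => // i y x _ <-; rewrite cReD. Qed.
Lemma cIm_sum (I : Type) (r : seq I) (P : pred I) (f : I -> C) :
  cIm (\sum_(i <- r | P i) f i) = \sum_(i <- r | P i) cIm (f i).
Proof. by elim/big_rec2 : _ => // i y x _ <-; rewrite cImD. Qed.

Lemma complex_ext (z w : C) : cRe z = cRe w -> cIm z = cIm w -> z = w.
Proof. by case: z => a b; case: w => c d /= -> ->. Qed.

Lemma nm_le_ReIm (z : C) : nm z <= `|cRe z| + `|cIm z|.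
Proof.
have {1}-> : z = ofR (cRe z) + Complex 0 1 * ofR (cIm z).
  by apply: complex_ext; rewrite ?cReD ?cImD ?cReM ?cImM /=; ring.
apply: le_trans (nmD _ _) _.
by rewrite nmM !nm_ofR nm_complex expr0n /= add0r expr1n sqrtr1 mul1r.
Qed.

Lemma gt0_complex_ex (e : C) : 0 < e -> exists2 d : R, 0 < d & e = ofR d.
Proof.
move=> e0; have he : ofR (cRe e) = e by apply/ge0_ofR_cRe/ltW.
by exists (cRe e); rewrite // -ofR_lt he.
Qed.

Lemma nbhs_nm (V : normedModType C) (v : V) (A : set V) :
  (exists2 d : R, 0 < d & forall w, nm (w - v) < d -> A w) -> nbhs v A.
Proof.
move=> [d d0 h]; apply/nbhs_normP; exists (ofR d); first by rewrite /= -ofR0 ofR_lt.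
move=> w /=; rewrite -nmE ofR_lt nmB; exact: h.
Qed.

Lemma nbhs_nmE (V : normedModType C) (v : V) (A : set V) :
  nbhs v A -> exists2 d : R, 0 < d & forall w, nm (w - v) < d -> A w.
Proof.
move=> /nbhs_normP[e /= /gt0_complex_ex[d d0 ->] h]; exists d => // w hw.
by apply: h; rewrite /= -nmE ofR_lt nmB.
Qed.

Lemma cvg_nm (T : Type) (F : set_system T) (FF : Filter F) (V : normedModType C)
    (f : T -> V) (l : V) :
  (forall e : R, 0 < e -> \forall x \near F, nm (f x - l) < e) -> f @ F --> l.
Proof.
move=> h; apply/cvgrPdist_lt => e /gt0_complex_ex[d d0 ->].
by apply: filterS (h d d0) => x; rewrite -nmE ofR_lt nmB.
Qed.

Lemma nm_coord n (v : 'rV[C]_n) j : nm (v 0 j) <= nm v.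
Proof.
rewrite -ofR_le !nmE [leRHS]/Num.norm /= mx_normE.
rewrite -[leLHS]nngE num_le.
exact: (@le_bigmax _ _ _ 0%:nng (fun i : 'I_1 * 'I_n => `|v i.1 i.2|%:nng) (0, j)).
Qed.

End RealNorm.

(** * Absolutely convergent sums over an arbitrary index set *)

Section Sums.
Context {R : realType} {I : choiceType}.
Local Notation C := (cplx R).
Implicit Types (f g : I -> C) (A B : {fset I}).

Definition bounded_sums f (M : R) : Prop :=
  forall A, \sum_(i <- A) nm (f i) <= M.

(** Unconditional summation: convergence along the filter of finite index
    sets. *)
Definition sums_to f (l : C) : Prop :=
  forall e : R, 0 < e -> exists A, forall B, (A `<=` B)%fset ->
    nm (\sum_(i <- B) f i - l) < e.

Lemma ler_sum_fset (g : I -> R) A B : (forall i, 0 <= g i) ->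
  (A `<=` B)%fset -> \sum_(i <- A) g i <= \sum_(i <- B) g i.
Proof.
move=> g0 AB; rewrite [leRHS](big_fsetID _ (mem A))/=.
rewrite (_ : [fset x in B | x \in A]%fset = A).
  by rewrite lerDl sumr_ge0.
apply/fsetP => i; rewrite !inE/=; apply: andb_idl; exact: (fsubsetP AB).
Qed.

Lemma sums_to_nonneg (g : I -> R) (M : R) : (forall i, 0 <= g i) ->
  (forall A, \sum_(i <- A) g i <= M) ->
  exists l, sums_to (fun i => ofR (g i)) l.
Proof.
move=> g0 gM; pose S := [set \sum_(i <- A) g i | A in [set: {fset I}]].
have hS : has_sup S.
  split; first by exists (\sum_(i <- fset0) g i), fset0.
  by exists M => _ [A _ <-].
exists (ofR (sup S)) => e e0.
have [_ [A _ <-] hA] := sup_adherent e0 hS.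
exists A => B AB.
rewrite -ofR_sum -ofRB nm_ofR distrC ger0_norm.
  by rewrite ltrBlDr -ltrBlDl; apply: lt_le_trans hA _; exact: ler_sum_fset.
rewrite subr_ge0; apply: sup_upper_bound => //.
by exists B.
Qed.

Lemma sums_toD f g l m : sums_to f l -> sums_to g m ->
  sums_to (fun i => f i + g i) (l + m).
Proof.
move=> hf hg e e0; have e20 : 0 < e / 2 by rewrite divr_gt0.
have [A hA] := hf _ e20; have [B hB] := hg _ e20.
exists (A `|` B)%fset => D; rewrite fsubUset => /andP[/hA AD /hB BD].
rewrite big_split/= (splitr e).
have -> : forall a b : C, a + b - (l + m) = (a - l) + (b - m) by move=> a b; ring.
by apply: le_lt_trans (nmD _ _) _; apply: ltrD.
Qed.

Lemma sums_toZ f l (a : C) : sums_to f l -> sums_to (fun i => a * f i) (a * l).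
Proof.
move=> hf e e0.
have e20 : 0 < e / (nm a + 1) by rewrite divr_gt0 // ltr_wpDl// nm_ge0.
have [A hA] := hf _ e20; exists A => B /hA; rewrite -mulr_sumr -mulrBr nmM.
rewrite ltr_pdivlMr ?ltr_wpDl// ?nm_ge0//; apply: le_lt_trans.
by rewrite mulrC ler_wpM2l ?nm_ge0// lerDl.
Qed.

Lemma sums_to_ext f g l : f =1 g -> sums_to f l -> sums_to g l.
Proof. by move=> /funext ->. Qed.

Lemma sums_to_nm f l M : sums_to f l -> bounded_sums f M -> nm l <= M.
Proof.
move=> hf hM; apply/ler_addgt0Pr => e e0.
have [A /(_ A (fsubset_refl _)) hA] := hf _ e0.
rewrite -[l](subrK (\sum_(i <- A) f i)) addrC.
apply: le_trans (nmD _ _) _; apply: lerD; last by rewrite nmB ltW.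
by apply: le_trans (hM A); exact: nm_sum.
Qed.

Lemma sum_sums_to f l : sums_to f l -> summability.sum f = l.
Proof.
move=> hf; rewrite /summability.sum.
have FF : ProperFilter (@summability.totally I) by exact: summability.totally_filter.
apply: cvg_lim; first exact: norm_hausdorff.
apply: cvg_nm => e /hf[A hA]; exists A => // B /= AB.
have <- : \sum_(i <- B) f i = summability.partial_sum f B by rewrite big_seq_fsetE.
exact: hA.
Qed.

Lemma bounded_sums_le f g M : (forall i, nm (g i) <= nm (f i)) ->
  bounded_sums f M -> bounded_sums g M.
Proof. by move=> gf fM A; apply: le_trans (fM A); apply: ler_sum. Qed.

Lemma bounded_sumsZ f (a : C) M : bounded_sums f M ->
  bounded_sums (fun i => a * f i) (nm a * M).
Proof.
move=> fM A; under eq_bigr do rewrite nmM.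
by rewrite -mulr_sumr ler_wpM2l ?nm_ge0.
Qed.

(** Completeness enters only through suprema of sets of real numbers: the real
    and imaginary parts [g] are written as [(g + nm f) - nm f], a difference of
    two families of nonnegative terms with bounded sums. *)
Lemma bounded_sums_to f M : bounded_sums f M -> exists l, sums_to f l.
Proof.
move=> fM.
have shift (g : I -> R) : (forall i, `|g i| <= nm (f i)) ->
    exists l, sums_to (fun i => ofR (g i)) l.
  move=> gf.
  have [] := @sums_to_nonneg (fun i => g i + nm (f i)) (M + M).
  - by move=> i; have := gf i; rewrite ler_norml => /andP[+ _]; rewrite lerNl; lra.
  - move=> A; rewrite big_split lerD//; apply: le_trans (fM A).
    by apply: ler_sum => i _; apply: le_trans (gf i); exact: ler_norm.
  move=> l hl.
  have [m hm] := @sums_to_nonneg _ M (fun i => nm_ge0 (f i)) fM.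
  exists (l + -1 * m); apply: sums_to_ext (sums_toD hl (sums_toZ (-1) hm)).
  by move=> i; rewrite /= mulN1r ofRD addrK.
have [a ha] := shift (@cRe R \o f) (fun i => cRe_nm (f i)).
have [b hb] := shift (@cIm R \o f) (fun i => cIm_nm (f i)).
exists (a + Complex 0 1 * b).
apply: sums_to_ext (sums_toD ha (sums_toZ _ hb)) => i /=.
by apply: complex_ext; rewrite ?cReD ?cImD ?cReM ?cImM /=; ring.
Qed.

Lemma sum_bounded_sums f M : bounded_sums f M -> sums_to f (summability.sum f).
Proof. by move=> /bounded_sums_to[l hl]; rewrite (sum_sums_to hl). Qed.

Lemma summable_bounded_sums f :
  summable [set: I] (fun i => (cRe `|f i|)%:E) -> exists M, bounded_sums f M.
Proof.
rewrite summableE => hf.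
exists (fine (\esum_(i in [set: I]) `|(cRe `|f i|)%:E|%E)) => A.
rewrite -lee_fin fineK//; apply: esum_ge; exists [set` A].
  by split => //; exact: finite_fset.
rewrite fsbig_finite//= set_fsetK -sumEFin.
by apply: lee_sum => i _; rewrite lee_fin ler_norm.
Qed.

End Sums.

(** * The complex exponential *)

Section Cexp.
Context {R : realType}.
Local Notation C := (cplx R).
Implicit Types (x y : R) (z w : C).

Lemma cexpD z w : cexp (z + w) = cexp z * cexp w.
Proof.
rewrite /cexp cReD cImD expRD cosD sinD.
by apply: complex_ext; rewrite ?cReM ?cImM /= ?cReM ?cImM /=; ring.
Qed.

Lemma cexp0 : cexp (0 : C) = 1.
Proof.
by rewrite /cexp /= expR0 cos0 sin0; apply: complex_ext; rewrite ?cReM ?cImM /=; ring.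
Qed.

Lemma nm_cexp z : nm (cexp z) = expR (cRe z).
Proof.
by rewrite /cexp nmM nm_ofR nm_complex cos2Dsin2 sqrtr1 mulr1 ger0_norm ?expR_ge0.
Qed.

Lemma cexp_nat (m : nat) : cexp (twopii R * m%:R) = 1.
Proof.
elim: m => [|m IH]; first by rewrite mulr0 cexp0.
rewrite -natr1 mulrDr cexpD IH mul1r mulr1 /cexp /twopii /=.
by rewrite expR0 mulr_natl cos2pi sin2pi mul1r.
Qed.

Lemma cexp_int z : is_intC z -> cexp (twopii R * z) = 1.
Proof.
move=> [[m|m] ->]; first exact: cexp_nat.
have := cexpD (twopii R * (Negz m)%:~R) (twopii R * m.+1%:R).
by rewrite cexp_nat mulr1 => <-; rewrite NegzE mulrNz mulrN addNr cexp0.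
Qed.

(** The mean value theorem on the segment between [0] and [y], for either sign
    of [y]. *)
Lemma mean_value0 (f df : R -> R) y : (forall x, is_derive x 1 f (df x)) ->
  exists2 c, `|c| <= `|y| & f y - f 0 = df c * y.
Proof.
move=> hf.
have cf a b : {within `[a, b], continuous f}.
  apply: continuous_subspaceT => x.
  by apply/differentiable_continuous/derivable1_diffP; case: (hf x).
have [y0|y0] := leP 0 y.
  have [c + e] := MVT_segment y0 (fun x _ => hf x) (cf 0 y).
  rewrite in_itv /= => /andP[c0 cy]; exists c; last by rewrite e subr0.
  by rewrite !ger0_norm.
have [c + e] := MVT_segment (ltW y0) (fun x _ => hf x) (cf y 0).
rewrite in_itv /= => /andP[c0 cy]; exists c.
  by rewrite !ler0_norm ?lerN2 // ltW.
by rewrite -opprB e sub0r mulrN opprK.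
Qed.

Lemma norm_sin_le y : `|sin y| <= `|y|.
Proof.
have [c _] := @mean_value0 (@sin R) (@cos R) y (fun x => is_derive_sin x).
rewrite sin0 subr0 => ->; rewrite normrM ler_piMl//; exact: cos_max.
Qed.

Lemma norm_cosB1_le y : `|cos y - 1| <= y ^+ 2.
Proof.
have [c cy] := @mean_value0 (@cos R) (fun x => - sin x) y (fun x => is_derive_cos x).
rewrite cos0 => ->; rewrite normrM normrN -[leRHS]ger0_norm ?sqr_ge0// expr2 normrM.
by rewrite ler_wpM2r//; apply: le_trans cy; exact: norm_sin_le.
Qed.

Lemma norm_sinB_le y : `|sin y - y| <= y ^+ 2.
Proof.
have [c cy] := @mean_value0 (fun x => sin x - x) (fun x => cos x - 1) y
  (fun x => is_deriveB (is_derive_sin x) (is_derive_id x 1)).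
rewrite sin0 subrr subr0 => ->; rewrite normrM -[leRHS]ger0_norm ?sqr_ge0//.
rewrite expr2 normrM ler_wpM2r//; apply: le_trans cy.
have [b _] := @mean_value0 (@cos R) (fun x => - sin x) c (fun x => is_derive_cos x).
by rewrite cos0 => ->; rewrite normrM normrN ler_piMl// sin_max.
Qed.

Lemma norm_expRB1_le x : `|expR x - 1| <= `|x| * expR `|x|.
Proof.
have h1 := expR_ge1Dx x; have h2 := expR_ge1Dx (- x).
have h3 : expR x * expR (- x) = 1 := expRxMexpNx_1 x.
have h4 := expR_gt0 x.
have h6 : expR x * (1 - x) <= 1 by rewrite -[leRHS]h3 ler_pM2l.
have [x0|x0] := leP 0 x.
  by rewrite (ger0_norm x0) ger0_norm; lra.
have h5 : 1 <= expR (- x) by rewrite -expR0 ler_expR; lra.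
rewrite (ltr0_norm x0) ler0_norm; last by rewrite subr_le0 expR_le1 ltW.
apply: (@le_trans _ _ (- x * 1)); first lra.
by rewrite ler_wpM2l//; lra.
Qed.

Lemma norm_expRB1B_le x : `|expR x - 1 - x| <= x ^+ 2 * expR `|x|.
Proof.
have h1 := expR_ge1Dx x; have h2 := expR_ge1Dx (- x).
have h3 : expR x * expR (- x) = 1 := expRxMexpNx_1 x.
have h4 := expR_gt0 x.
have h6 : expR x * (1 - x) <= 1 by rewrite -[leRHS]h3 ler_pM2l.
rewrite ger0_norm; last by lra.
have [x0|x0] := leP 0 x.
  rewrite (ger0_norm x0); apply: (@le_trans _ _ (x * (expR x - 1))); first lra.
  by rewrite expr2 -mulrA ler_wpM2l//; lra.
have h5 : 1 <= expR (- x) by rewrite -expR0 ler_expR; lra.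
rewrite (ltr0_norm x0); apply: (@le_trans _ _ (x ^+ 2 * 1)).
  by rewrite mulr1 expr2; nra.
by rewrite ler_wpM2l ?sqr_ge0.
Qed.

(** The real and imaginary parts of [exp (x + i y) - 1 - (x + i y)] split into
    four terms, each of second order in [x] and [y]. *)
Lemma cexp_quadratic z : nm (cexp z - 1 - z) <= 4 * nm z ^+ 2 * expR (nm z).
Proof.
apply: le_trans (nm_le_ReIm _) _.
have hx := cRe_nm z; have hy := cIm_nm z.
have n0 := nm_ge0 z.
set a := nm z in hx hy n0 *.
have -> : cRe (cexp z - 1 - z) =
    (expR (cRe z) - 1 - cRe z) + expR (cRe z) * (cos (cIm z) - 1).
  by rewrite /cexp !cReD !cReN cReM /=; ring.
have -> : cIm (cexp z - 1 - z) =
    expR (cRe z) * (sin (cIm z) - cIm z) + cIm z * (expR (cRe z) - 1).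
  by rewrite /cexp !cImD !cImN cImM /=; ring.
set x := cRe z in hx *; set y := cIm z in hy *.
have E0 := expR_gt0 x.
have EA : expR x <= expR a by rewrite ler_expR; apply: le_trans hx; exact: ler_norm.
have EA' : expR `|x| <= expR a by rewrite ler_expR.
have A0 := expR_gt0 a.
have x2 : x ^+ 2 <= a ^+ 2 by rewrite -[x ^+ 2]ger0_norm ?sqr_ge0// normrX lerXn2r ?nnegrE.
have y2 : y ^+ 2 <= a ^+ 2 by rewrite -[y ^+ 2]ger0_norm ?sqr_ge0// normrX lerXn2r ?nnegrE.
have b1 : `|expR x - 1 - x| <= a ^+ 2 * expR a.
  by apply: le_trans (norm_expRB1B_le _) _; apply: ler_pM; rewrite ?sqr_ge0 ?expR_ge0.
have b2 : `|expR x * (cos y - 1)| <= a ^+ 2 * expR a.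
  rewrite normrM mulrC ler_pM// ?(le_trans (norm_cosB1_le _))//.
  by rewrite gtr0_norm.
have b3 : `|expR x * (sin y - y)| <= a ^+ 2 * expR a.
  rewrite normrM mulrC ler_pM// ?(le_trans (norm_sinB_le _))//.
  by rewrite gtr0_norm.
have b4 : `|y * (expR x - 1)| <= a ^+ 2 * expR a.
  rewrite normrM expr2 -mulrA ler_pM//.
  by apply: le_trans (norm_expRB1_le _) _; rewrite ler_pM.
have -> : 4 * a ^+ 2 * expR a = (a ^+ 2 * expR a + a ^+ 2 * expR a)
   + (a ^+ 2 * expR a + a ^+ 2 * expR a) by ring.
by apply: lerD; apply: le_trans (ler_normD _ _) _; apply: lerD.
Qed.

End Cexp.

(** * Differentiability from a quadratic error bound *)

Section Differentiability.
Context {R : realType} {n : nat}.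
Local Notation C := (cplx R).

Definition linform (a : 'I_n -> C) (v : 'rV[C]_n) : C := \sum_j v 0 j * a j.

Lemma linform_is_linear a : linear (linform a).
Proof.
move=> k v w; rewrite /linform scaler_sumr -big_split /=; apply: eq_bigr => j _.
by rewrite !mxE mulrDl -mulrA.
Qed.

HB.instance Definition _ a :=
  GRing.isLinear.Build C 'rV[C]_n C _ (linform a) (linform_is_linear a).

Lemma continuous_linform a : continuous (linform a).
Proof.
move=> v; have -> : linform a = \sum_(j < n) (fun v : 'rV[C]_n => v 0 j * a j).
  by apply/funext => w; rewrite /linform fct_sumE.
apply/differentiable_continuous/differentiable_sum => j.
by apply: differentiableM; [exact: differentiable_coord|exact: differentiable_cst].
Qed.

Lemma linform_delta a j : linform a (delta_mx 0 j) = a j.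
Proof.
rewrite /linform (bigD1 j)//= mxE !eqxx mul1r big1 ?addr0// => i ij.
by rewrite mxE (negbTE ij) andbF mul0r.
Qed.

Lemma nm_linform a v : nm (linform a v) <= (\sum_j nm (a j)) * nm v.
Proof.
apply: le_trans (nm_sum _ _ _) _; rewrite mulr_suml; apply: ler_sum => j _.
by rewrite nmM mulrC ler_wpM2l ?nm_ge0// nm_coord.
Qed.

(** A remainder bounded by [M * nm v ^ 2] is [o(v)], which turns estimates of
    the terms of a series into differentiability of its sum. *)
Lemma is_diff_quadratic (f : 'rV[C]_n -> C) (u : 'rV[C]_n) (a : 'I_n -> C) (M d : R) :
  0 < d -> (forall v, nm v < d -> nm (f (v + u) - f u - linform a v) <= M * nm v ^+ 2) ->
  differentiable f u /\ forall v, 'd f u v = linform a v.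
Proof.
move=> d0 hf.
have key : f \o shift u = cst (f u) + linform a +o_ (0 : 'rV[C]_n) id.
  apply/eqaddoP => e /gt0_complex_ex[r r0 ->]; apply: nbhs_nm.
  have M0 : 0 < `|M| + 1 by rewrite ltr_wpDl.
  exists (Num.min d (r / (`|M| + 1))); first by rewrite lt_min d0 divr_gt0.
  move=> v; rewrite subr0 lt_min => /andP[vd vr].
  have -> : (f \o shift u - (cst (f u) + linform a)) v
    = f (v + u) - f u - linform a v by rewrite !fctE opprD addrA.
  rewrite -!nmE -ofRM ofR_le; apply: le_trans (hf v vd) _.
  rewrite expr2 mulrA ler_wpM2r ?nm_ge0//.
  rewrite ltr_pdivlMr// in vr; apply: ltW; apply: le_lt_trans vr.
  rewrite mulrC ler_wpM2l ?nm_ge0//; have := ler_norm M; lra.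
have dE := diff_unique (@continuous_linform a) key.
split; last by move=> v; rewrite dE.
by apply/diff_locallyP; rewrite dE; split => //; exact: continuous_linform.
Qed.

End Differentiability.

(** * Exponential series on the product of upper half-planes *)

Section ExponentialSeries.
Context {R : realType} {n : nat} {I : choiceType}.
Local Notation C := (cplx R).
Variable (deg : I -> 'I_n -> R).
Implicit Types (c : I -> C) (u v : 'rV[C]_n) (i : I) (j k : 'I_n).

Definition pairing i u : C := \sum_j u 0 j * ofR (deg i j).

(** Kept folded: the exponential is itself defined as a product, which
    multiplicativity of the norm would otherwise split. *)
Definition exp_term i u : C := locked (@cexp R) (twopii R * pairing i u).

Lemma exp_termE i u : exp_term i u = cexp (twopii R * pairing i u).
Proof. by rewrite /exp_term -lock. Qed.

Definition exp_series c u : C := summability.sum (fun i => c i * exp_term i u).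

Definition total_degree i : R := \sum_j deg i j.

(** Nonnegative exponents make each monomial holomorphic across [q = 0]. *)
Definition effective c : Prop := forall i, c i != 0 -> forall j, 0 <= deg i j.

Definition abs_convergent c : Prop :=
  forall u, upper_half u -> exists M, bounded_sums (fun i => c i * exp_term i u) M.

Lemma pairingD i u v : pairing i (u + v) = pairing i u + pairing i v.
Proof. by rewrite /pairing -big_split/=; apply: eq_bigr => j _; rewrite mxE mulrDl. Qed.

Lemma exp_termD i u v : exp_term i (u + v) = exp_term i u * exp_term i v.
Proof. by rewrite !exp_termE pairingD mulrDr cexpD. Qed.

Lemma pairing_delta i j : pairing i (delta_mx 0 j) = ofR (deg i j).
Proof. exact: linform_delta. Qed.

(** Adding [vertical t] with [t] large moves towards the large radius limit. *)
Definition vertical (t : R) : 'rV[C]_n := const_mx (Complex 0 t).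

Lemma nm_exp_term_vertical i t :
  nm (exp_term i (vertical t)) = expR (- (2 * pi * t * total_degree i)).
Proof.
rewrite exp_termE nm_cexp; congr expR.
have -> : pairing i (vertical t) = Complex 0 (t * total_degree i).
  rewrite /pairing /total_degree mulr_sumr.
  apply: complex_ext; rewrite ?cRe_sum ?cIm_sum /=.
    by apply: big1 => j _; rewrite mxE cReM /= !mul0r mulr0 subrr.
  by apply: eq_bigr => j _; rewrite mxE cImM /= !mul0r add0r.
by rewrite cReM /=; ring.
Qed.

Lemma upper_half_lower u : upper_half u -> exists2 d : R, 0 < d &
  forall j, d < cIm (u 0 j).
Proof.
move=> hu; exists ((\big[Num.min/1]_j cIm (u 0 j)) / 2).
  rewrite divr_gt0//; elim/big_ind : _ => // x y x0 y0.
  by rewrite lt_min x0 y0.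
move=> j; rewrite ltr_pdivrMr//.
apply: (@le_lt_trans _ _ (cIm (u 0 j))); first exact: bigmin_le_cond.
by have := hu j; lra.
Qed.

Lemma open_upper_half : open (@upper_half R n).
Proof.
rewrite openE => u /upper_half_lower[d d0 hd]; apply: nbhs_nm.
exists d => // w hw j.
have := cIm_nm ((w - u) 0 j); have := nm_coord (w - u) j.
rewrite !mxE cImD cImN => h1 h2.
have := le_trans h2 h1; rewrite ler_norml => /andP[h3 _].
by have := hd j; lra.
Qed.

Lemma upper_half_vertical u d : (forall j, d < cIm (u 0 j)) ->
  upper_half (u - vertical d).
Proof. by move=> hd j; rewrite !mxE cImD cImN /= subr_gt0. Qed.

Lemma deg_le_total i j : (forall k, 0 <= deg i k) -> deg i j <= total_degree i.
Proof. by move=> h; rewrite /total_degree (bigD1 j)//= lerDl sumr_ge0. Qed.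

Lemma effectiveM c (b : I -> C) : effective c -> effective (fun i => b i * c i).
Proof. by move=> h i; rewrite mulf_eq0 negb_or => /andP[_ /h]. Qed.

Lemma nm_exp_term_lower i u d : nm (exp_term i (u - vertical d)) =
  nm (exp_term i u) * expR (2 * pi * d * total_degree i).
Proof.
have -> : - vertical d = vertical (- d).
  by apply/rowP => j; rewrite !mxE; apply: complex_ext; rewrite /= ?oppr0.
by rewrite exp_termD nmM nm_exp_term_vertical; congr (_ * expR _); ring.
Qed.

(** There is room below [u] in the product of half-planes: moving down by [d]
    multiplies the term of total degree [s] by [exp (2 pi d s)], which absorbs
    the factor given by the degree. *)
Lemma deg_abs_convergent c k : effective c -> abs_convergent c ->
  abs_convergent (fun i => ofR (deg i k) * c i).
Proof.
move=> ceff hc u hu; have [d d0 hd] := upper_half_lower hu.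
have [M hM] := hc _ (upper_half_vertical hd).
exists (nm (ofR (2 * pi * d)^-1 : C) * M).
apply: bounded_sums_le (bounded_sumsZ (ofR (2 * pi * d)^-1) hM) => i.
have p0 : 0 < 2 * pi * d :> R by rewrite !mulr_gt0// pi_gt0.
have [->|ci] := eqVneq (c i) 0; first by rewrite !(mulr0, mul0r).
have deg0 := ceff i ci.
rewrite !nmM nm_exp_term_lower !nm_ofR [X in X * (_ * _)]ger0_norm ?invr_ge0 ?(ltW p0)//.
rewrite ger0_norm// ler_pdivlMl// [leRHS]mulrA [leRHS]mulrC.
rewrite -[deg i k * _ * _]mulrA [leLHS]mulrA.
apply: ler_wpM2r; first by rewrite mulr_ge0 ?nm_ge0.
apply: (@le_trans _ _ (2 * pi * d * total_degree i)).
  by rewrite ler_pM2l// deg_le_total.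
by have := expR_ge1Dx (2 * pi * d * total_degree i); lra.
Qed.

Lemma sqr_le_expR (x a : R) : 0 <= x -> 0 < a ->
  x ^+ 2 * expR (x * (a / 2)) <= (4 / a) ^+ 2 * expR (x * a).
Proof.
move=> x0 a0.
have -> : expR (x * a) = expR (x * (a / 4)) ^+ 2 * expR (x * (a / 2)).
  by rewrite expr2 -!expRD; congr expR; field.
rewrite [leRHS]mulrA; apply: ler_wpM2r; first exact: expR_ge0.
rewrite -exprMn lerXn2r ?nnegrE//.
  by rewrite mulr_ge0 ?expR_ge0// divr_ge0// ltW.
rewrite mulrAC ler_pdivlMr//.
by have := expR_ge1Dx (x * (a / 4)); lra.
Qed.

Lemma sums_to_sum c (a : 'I_n -> C) u :
  (forall j, exists M, bounded_sums (fun i => ofR (deg i j) * c i * exp_term i u) M) ->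
  sums_to (fun i => (\sum_j a j * ofR (deg i j)) * (c i * exp_term i u))
   (\sum_j a j * exp_series (fun i => ofR (deg i j) * c i) u).
Proof.
move=> h.
have sums_to0 : sums_to (fun _ : I => 0 : C) 0.
  by move=> e e0; exists fset0 => B _; rewrite big1// subrr nm0.
apply: (@sums_to_ext _ _ (fun i => \sum_j a j * (ofR (deg i j) * c i * exp_term i u))).
  by move=> i; rewrite mulr_suml; apply: eq_bigr => j _; rewrite !mulrA.
elim: (index_enum _) => [|j s IH].
  by apply: (sums_to_ext (f := fun=> 0)); [move=> i|]; rewrite ?big_nil.
rewrite big_cons; apply: sums_to_ext (sums_toD _ IH) => [i|].
  by rewrite big_cons.
have [M hM] := h j; apply: sums_toZ; exact: sum_bounded_sums hM.
Qed.

(** Termwise differentiation. The remainder of the term of total degree [s] is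
    of order [s ^ 2 * exp (2 pi s * nm v)]; for [nm v < d / 2] this is absorbed
    by the factor [exp (2 pi d s)] gained by moving down by [d], so the series
    of remainders is bounded by the series of absolute values at a lower
    point. *)
Lemma exp_series_diff c u : effective c -> abs_convergent c -> upper_half u ->
  differentiable (exp_series c) u /\
  forall v, 'd (exp_series c) u v =
    linform (fun j => twopii R * exp_series (fun i => ofR (deg i j) * c i) u) v.
Proof.
move=> ceff hc hu; have [d d0 hd] := upper_half_lower hu.
have [M hM] := hc _ (upper_half_vertical hd).
(* The [4] of [cexp_quadratic] times the constant of [sqr_le_expR]. *)
pose K := 4 * (4 / d) ^+ 2.
apply: (@is_diff_quadratic _ _ _ _ _ (K * M) (d / 2)); first by rewrite divr_gt0.
move=> v hv.
have hvu : upper_half (v + u).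
  move=> j; have := cIm_nm (v 0 j); have := nm_coord v j => h1 h2.
  have := le_trans h2 h1; rewrite ler_norml => /andP[h3 _].
  by rewrite mxE cImD; have := hd j; lra.
have [M1 hM1] := hc _ hu; have [M2 hM2] := hc _ hvu.
have s1 := sum_bounded_sums hM1; have s2 := sum_bounded_sums hM2.
have s3 := sums_to_sum (fun j => v 0 j * twopii R)
  (fun j => deg_abs_convergent j ceff hc hu).
have s4 := sums_toD (sums_toD s2 (sums_toZ (-1) s1)) (sums_toZ (-1) s3).
have -> : K * M * nm v ^+ 2 = K * nm v ^+ 2 * M by ring.
have {1}-> : exp_series c (v + u) - exp_series c u -
   linform (fun j => twopii R * exp_series (fun i => ofR (deg i j) * c i) u) v
   = summability.sum (fun i => c i * exp_term i (v + u))
     + -1 * summability.sum (fun i => c i * exp_term i u)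
     + -1 * (\sum_j v 0 j * twopii R * exp_series (fun i => ofR (deg i j) * c i) u).
  rewrite !mulN1r /linform; congr (_ - _ - _).
  by apply: eq_bigr => j _; rewrite mulrA.
apply: (sums_to_nm s4).
have K0 : 0 <= K * nm v ^+ 2.
  by rewrite mulr_ge0 ?exprn_ge0 ?nm_ge0// mulr_ge0// exprn_ge0// divr_ge0// ltW.
have -> : K * nm v ^+ 2 * M = nm (ofR (K * nm v ^+ 2) : C) * M.
  by rewrite nm_ofR ger0_norm.
apply: bounded_sums_le (bounded_sumsZ (ofR (K * nm v ^+ 2)) hM) => i.
pose z := twopii R * pairing i v.
have -> : c i * exp_term i (v + u) + -1 * (c i * exp_term i u)
   + -1 * ((\sum_j v 0 j * twopii R * ofR (deg i j)) * (c i * exp_term i u))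
   = (c i * exp_term i u) * (cexp z - 1 - z).
  have -> : \sum_j v 0 j * twopii R * ofR (deg i j) = z.
    by rewrite /z /pairing mulr_sumr; apply: eq_bigr => j _; ring.
  by rewrite exp_termD [exp_term i v]exp_termE -/z; ring.
have [->|ci] := eqVneq (c i) 0; first by rewrite !(mulr0, mul0r) nm0.
have deg0 := ceff i ci.
have t0 : 0 <= total_degree i by apply: sumr_ge0.
rewrite !nmM nm_exp_term_lower nm_ofR (ger0_norm K0).
rewrite [nm (c i) * (_ * _)]mulrA [leRHS]mulrCA.
apply: ler_wpM2l; first by rewrite mulr_ge0 ?nm_ge0.
set x := 2 * pi * total_degree i.
have x0 : 0 <= x by rewrite mulr_ge0// mulr_ge0// pi_ge0.
have zx : nm z <= x * nm v.
  rewrite /z nmM /twopii nm_complex expr0n /= add0r sqrtr_sqr ger0_norm; last first.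
    by rewrite mulr_ge0// pi_ge0.
  rewrite /x -!mulrA; apply: ler_wpM2l => //; apply: ler_wpM2l; first exact: pi_ge0.
  apply: le_trans (nm_linform _ _) _; apply: ler_wpM2r; first exact: nm_ge0.
  by apply: ler_sum => j _; rewrite nm_ofR ger0_norm.
apply: le_trans (cexp_quadratic _) _.
apply: (@le_trans _ _ (4 * (x * nm v) ^+ 2 * expR (x * (d / 2)))).
  apply: ler_pM; rewrite ?expR_ge0 ?mulr_ge0 ?exprn_ge0 ?nm_ge0//.
    apply: ler_wpM2l => //; apply: lerXn2r => //; rewrite nnegrE ?nm_ge0//.
    by rewrite mulr_ge0// nm_ge0.
  rewrite ler_expR; apply: le_trans zx _; apply: ler_wpM2l => //; exact: ltW.
have := sqr_le_expR x0 d0.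
have -> : 2 * pi * d * total_degree i = x * d by rewrite /x; ring.
move=> h; rewrite exprMn.
have := ler_wpM2l (_ : 0 <= 4 * nm v ^+ 2) h; rewrite mulr_ge0 ?exprn_ge0 ?nm_ge0//.
move=> /(_ isT); rewrite /K; congr (_ <= _); ring.
Qed.

Lemma exp_series_periodic c u j : (forall i, c i != 0 -> is_intC (ofR (deg i j))) ->
  exp_series c (u + delta_mx 0 j) = exp_series c u.
Proof.
move=> hc; congr summability.sum; apply/funext => i.
have [->|ci] := eqVneq (c i) 0; first by rewrite !mul0r.
rewrite exp_termD [exp_term i (delta_mx _ _)]exp_termE pairing_delta.
by rewrite (cexp_int (hc i ci)) mulr1.
Qed.

(** Without constant term, every term acquires at least one factor
    [exp (- 2 pi t)] when [u] moves up by [t]. *)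
Lemma exp_series_decay c u : abs_convergent c ->
  (forall i, c i != 0 -> 1 <= total_degree i) -> upper_half u ->
  exists M, forall t, 0 <= t ->
    nm (exp_series c (u + vertical t)) <= M * expR (- (2 * pi * t)).
Proof.
move=> hc deg1 hu; have [M hM] := hc _ hu; exists M => t t0.
have hut : upper_half (u + vertical t).
  by move=> j; rewrite !mxE cImD /=; have := hu j; lra.
have [M1 hM1] := hc _ hut; apply: (sums_to_nm (sum_bounded_sums hM1)).
have -> : M * expR (- (2 * pi * t)) = nm (ofR (expR (- (2 * pi * t))) : C) * M.
  by rewrite nm_ofR ger0_norm ?expR_ge0// mulrC.
apply: bounded_sums_le (bounded_sumsZ (ofR (expR (- (2 * pi * t)))) hM) => i.
have [->|ci] := eqVneq (c i) 0; first by rewrite !(mulr0, mul0r).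
rewrite exp_termD !nmM nm_exp_term_vertical nm_ofR ger0_norm ?expR_ge0//.
rewrite mulrA mulrC ler_wpM2r ?mulr_ge0 ?nm_ge0// ler_expR lerN2.
by rewrite ler_peMr ?deg1// !mulr_ge0// pi_ge0.
Qed.

End ExponentialSeries.

(** * Partial derivatives of vector-valued maps, tested on linear forms *)

Section ScalarForms.
Context {R : realType} {V : lmodType (cplx R)} (l : V -> cplx R).
Hypothesis hl : scalar l.

Lemma scalar_formD x y : l (x + y) = l x + l y.
Proof. by have := hl 1 x y; rewrite scale1r mul1r. Qed.

Lemma scalar_form0 : l 0 = 0.
Proof. by have := hl (-1) 0 0; rewrite scaler0 addr0 mulN1r addNr. Qed.

Lemma scalar_formZ c x : l (c *: x) = c * l x.
Proof. by have := hl c x 0; rewrite addr0 scalar_form0 addr0. Qed.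

Lemma scalar_formN x : l (- x) = - l x.
Proof. by rewrite -scaleN1r scalar_formZ mulN1r. Qed.

Lemma scalar_formB x y : l (x - y) = l x - l y.
Proof. by rewrite scalar_formD scalar_formN. Qed.

Lemma scalar_form_sum (J : Type) (r : seq J) (a : J -> cplx R) (w : J -> V) :
  l (\sum_(i <- r) a i *: w i) = \sum_(i <- r) a i * l (w i).
Proof.
elim: r => [|i r IH]; first by rewrite !big_nil scalar_form0.
by rewrite !big_cons hl IH.
Qed.

End ScalarForms.

Section Partials.
Context {R : realType} {n : nat}.
Local Notation C := (cplx R).
Implicit Types (phi psi : 'rV[C]_n -> C) (u v : 'rV[C]_n) (d : 'I_n -> C).

Definition scalar_partials phi u d : Prop :=
  differentiable phi u /\ forall j, 'D_(delta_mx 0 j) phi u = d j.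

Lemma scalar_partials_eq phi u d d' : d =1 d' ->
  scalar_partials phi u d -> scalar_partials phi u d'.
Proof. by move=> dd [h hd]; split => // j; rewrite hd dd. Qed.

Lemma scalar_partials_diff phi u d v : scalar_partials phi u d ->
  'd phi u v = linform d v.
Proof.
move=> [df hd]; rewrite [in LHS](row_sum_delta v) linear_sum /=; apply: eq_bigr => j _.
by rewrite linearZ /= -deriveE// hd.
Qed.

Lemma scalar_partials_cst a u : scalar_partials (cst a) u (fun=> 0).
Proof. by split=> [|j]; [exact: differentiable_cst|rewrite derive_cst]. Qed.

Lemma scalar_partials_coord k u :
  scalar_partials (fun v => v 0 k) u (fun j => (j == k)%:R).
Proof.
have df : differentiable (fun v : 'rV[C]_n => v 0 k) u by exact: differentiable_coord.
split=> // j; rewrite deriveE//.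
have -> : 'd (fun v : 'rV[C]_n => v 0 k) u = (fun v : 'rV[C]_n => v 0 k) :> (_ -> _).
  have lin : linear (fun v : 'rV[C]_n => v 0 k : C) by move=> a x y; rewrite !mxE.
  pose L := GRing.isLinear.Build C 'rV[C]_n C _ _ lin.
  pose L' : {linear 'rV[C]_n -> C} := HB.pack (fun v : 'rV[C]_n => v 0 k : C) L.
  by apply: (@diff_lin _ _ _ L'); exact: coord_continuous.
by rewrite mxE eqxx eq_sym.
Qed.

Lemma scalar_partialsD phi psi u d e : scalar_partials phi u d ->
  scalar_partials psi u e ->
  scalar_partials (fun x => phi x + psi x) u (fun j => d j + e j).
Proof.
move=> [df hd] [dg he]; split; first exact: differentiableD.
by move=> j; rewrite deriveD ?hd ?he//; exact: diff_derivable.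
Qed.

Lemma scalar_partialsM phi psi u d e : scalar_partials phi u d ->
  scalar_partials psi u e ->
  scalar_partials (fun x => phi x * psi x) u (fun j => d j * psi u + phi u * e j).
Proof.
move=> [df hd] [dg he]; split; first exact: differentiableM.
move=> j; rewrite deriveM; [|exact: diff_derivable..].
by rewrite hd he addrC [_ *: d j]mulrC.
Qed.

Lemma scalar_partialsZ a phi u d : scalar_partials phi u d ->
  scalar_partials (fun x => a * phi x) u (fun j => a * d j).
Proof.
move=> h; apply: scalar_partials_eq (scalar_partialsM (scalar_partials_cst a u) h) => j.
by rewrite mul0r add0r.
Qed.

Lemma scalar_partials_sum (J : Type) (r : seq J) (phi : J -> 'rV[C]_n -> C) u
    (d : J -> 'I_n -> C) : (forall i, scalar_partials (phi i) u (d i)) ->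
  scalar_partials (fun x => \sum_(i <- r) phi i x) u (fun j => \sum_(i <- r) d i j).
Proof.
move=> h; elim: r => [|i r IH].
  have := scalar_partials_cst 0 u.
  rewrite (_ : cst 0 = fun x => \sum_(i <- [::]) phi i x); last first.
    by apply/funext => x; rewrite big_nil.
  by apply: scalar_partials_eq => j; rewrite big_nil.
have := scalar_partialsD (h i) IH.
rewrite (_ : (fun x => _ + _) = fun x => \sum_(i <- i :: r) phi i x); last first.
  by apply/funext => x; rewrite big_cons.
by apply: scalar_partials_eq => j; rewrite big_cons.
Qed.

Lemma scalar_partials_near phi psi u d : (\forall x \near u, phi x = psi x) ->
  scalar_partials phi u d -> scalar_partials psi u d.
Proof.
move=> h [df hd]; split; last by move=> j; rewrite -hd; apply/esym/near_eq_derive.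
have e : phi u = psi u := nbhs_singleton h.
have key : psi \o shift u = cst (psi u) + 'd phi u +o_ (0 : 'rV[C]_n) id.
  apply/eqaddoP => r r0.
  have /eqaddoP/(_ r r0) := diff_locally df.
  have := h; rewrite (near_shift 0 u) /= subr0 => h1 h2; near=> x.
  have -> : (psi \o shift u - (cst (psi u) + 'd phi u)) x
          = (phi \o shift u - (cst (phi u) + 'd phi u)) x.
    by rewrite !fctE -e; congr (_ - _); apply/esym; near: x.
  by near: x.
have E := diff_unique (diff_continuous df) key.
apply/diff_locallyP; rewrite E; split; [exact: diff_continuous|exact: key].
Unshelve. all: by end_near. Qed.

Section VectorValued.
Context {V : vectType C}.
Implicit Types (f g : 'rV[C]_n -> V) (l : V -> C).
Local Notation e := (vbasis {:V}).

(** Vector-valued maps are tested on linear forms, which reduces their calculus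
    to that of complex-valued functions and makes the chosen basis of [V]
    disappear. *)
Definition has_partials f u (d' : 'I_n -> V) : Prop :=
  forall l, scalar l -> scalar_partials (l \o f) u (l \o d').

Lemma scalar_rVof l : scalar l -> forall x,
  l x = linform (fun i => l e`_i) (passmx.rVof e x).
Proof.
move=> hl x; rewrite {1}(coord_vbasis (memvf x)) (scalar_form_sum hl).
by apply: eq_bigr => i _; rewrite mxE.
Qed.

Lemma linform_differentiable m (a : 'I_m -> C) (x : 'rV[C]_m) :
  differentiable (linform a) x.
Proof. by apply: linear_differentiable; exact: continuous_linform. Qed.

Lemma has_partials_of_diff f u :
  differentiable (fun x => passmx.rVof e (f x)) u ->
  has_partials f u (fun j => partial f j u).
Proof.
move=> df l hl.
have -> : l \o f = linform (fun i => l e`_i) \o (fun x => passmx.rVof e (f x)).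
  by apply/funext => x; rewrite /= (scalar_rVof hl).
have dl x := @linform_differentiable _ (fun i => l e`_i) x.
split; first exact: differentiable_comp.
move=> j; rewrite deriveE; last exact: differentiable_comp.
rewrite diff_comp//= diff_lin; last exact: continuous_linform.
rewrite [RHS](scalar_rVof hl) /partial passmx.vecofK; last exact: vbasisP.
by rewrite deriveE.
Qed.

Lemma diff_of_has_partials f u (d' : 'I_n -> V) : has_partials f u d' ->
  differentiable (fun x => passmx.rVof e (f x)) u /\
  forall j, partial f j u = d' j.
Proof.
move=> h.
have sc i : scalar (coord e i : V -> C) by move=> a x y; rewrite linearP.
have df : differentiable (fun x => passmx.rVof e (f x)) u.
  have -> : (fun x => passmx.rVof e (f x)) =
      \sum_i (fun x => coord e i (f x) *: delta_mx 0 i).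
    apply/funext => x; rewrite fct_sumE [LHS]row_sum_delta.
    by apply: eq_bigr => i _; rewrite mxE.
  apply: differentiable_sum => i; apply: differentiableZl.
  by have [] := h _ (sc i).
split=> // j; apply: (can_inj (passmx.rVofK (vbasisP _))).
apply/rowP => i; rewrite !mxE.
have [_ /(_ j)/= <-] := h _ (sc i).
by have [_ /(_ j)/= <-] := has_partials_of_diff df (sc i).
Qed.

Lemma has_partials_eq f u (d' d'' : 'I_n -> V) : d' =1 d'' ->
  has_partials f u d' -> has_partials f u d''.
Proof. by move=> h hf l hl; apply: scalar_partials_eq (hf l hl) => j /=; rewrite h. Qed.

Lemma has_partials_near f g u (d' : 'I_n -> V) : (\forall x \near u, f x = g x) ->
  has_partials f u d' -> has_partials g u d'.
Proof.
move=> h hf l hl; apply: scalar_partials_near (hf l hl).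
by apply: filterS h => x /= ->.
Qed.

Lemma has_partials_comb (J : Type) (r : seq J) (phi : J -> 'rV[C]_n -> C)
    (d : J -> 'I_n -> C) (w : J -> V) u :
  (forall i, scalar_partials (phi i) u (d i)) ->
  has_partials (fun x => \sum_(i <- r) phi i x *: w i) u
    (fun j => \sum_(i <- r) d i j *: w i).
Proof.
move=> h l hl.
have -> : l \o (fun x => \sum_(i <- r) phi i x *: w i) =
   fun x => \sum_(i <- r) l (w i) * phi i x.
  apply/funext => x; rewrite /= (scalar_form_sum hl).
  by apply: eq_bigr => i _; rewrite mulrC.
apply: scalar_partials_eq (scalar_partials_sum r (fun i => scalar_partialsZ (l (w i)) (h i))).
by move=> j /=; rewrite (scalar_form_sum hl); apply: eq_bigr => i _; rewrite mulrC.
Qed.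

End VectorValued.

Lemma vertical_add (s t : R) : vertical (s + t) = vertical s + vertical t :> 'rV[C]_n.
Proof. by apply/rowP => j; rewrite !mxE; apply: complex_ext; rewrite /= ?addr0. Qed.

Lemma verticalE (t : R) : vertical t = ofR t *: vertical 1 :> 'rV[C]_n.
Proof.
apply/rowP => j; rewrite !mxE.
by apply: complex_ext; rewrite ?cReM ?cImM /=; ring.
Qed.

Lemma upper_half_up u (t : R) : upper_half u -> 0 <= t -> upper_half (u + vertical t).
Proof. by move=> hu t0 j; rewrite !mxE cImD /=; have := hu j; lra. Qed.

Lemma zero_partials_littleo phi u : scalar_partials phi u (fun=> 0) ->
  forall e : R, 0 < e -> exists2 d : R, 0 < d & forall s, `|s| < d ->
    nm (phi (u + vertical s) - phi u) <= e * `|s|.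
Proof.
move=> hphi e e0; have [df _] := hphi.
pose K := nm (vertical 1 : 'rV[C]_n) + 1.
have K0 : 0 < K by rewrite ltr_wpDl// nm_ge0.
have eK : 0 < ofR (e / K) by rewrite -ofR0 ofR_lt divr_gt0.
have /eqaddoP/(_ _ eK)/nbhs_nmE[d d0 hd] := diff_locally df.
exists (d / K); first by rewrite divr_gt0.
move=> s hs.
have vs : nm (vertical s : 'rV[C]_n) <= K * `|s|.
  by rewrite verticalE nmZ nm_ofR mulrC ler_wpM2r// lerDl.
have := hd (vertical s); rewrite subr0 => /(_ _).
rewrite ltr_pdivlMr// mulrC in hs; move=> /(_ (le_lt_trans vs hs)).
have -> : (phi \o shift u - (cst (phi u) + 'd phi u)) (vertical s) =
    phi (u + vertical s) - phi u.
  rewrite !fctE (scalar_partials_diff _ hphi) /linform big1 ?addr0; last first.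
    by move=> i _; rewrite mulr0.
  by congr (phi _ - _); rewrite /= addrC.
rewrite -!nmE -ofRM ofR_le => /le_trans; apply.
rewrite -mulrA ler_pM2l// ler_pdivrMl//.
Qed.

(** Restricted to a vertical ray, the real and imaginary parts are real
    functions with vanishing derivative, to which the mean value theorem
    applies. *)
Lemma zero_partials_vertical phi :
  (forall u, upper_half u -> scalar_partials phi u (fun=> 0)) ->
  forall u (t : R), upper_half u -> 0 <= t -> phi (u + vertical t) = phi u.
Proof.
move=> h u t hu t0.
suff real (r : C -> R) : (forall z w, r z - r w = r (z - w)) ->
    (forall z, `|r z| <= nm z) -> r (phi (u + vertical t)) = r (phi u).
  apply: complex_ext; apply: real.
  - by move=> z w; rewrite cReD cReN.
  - exact: cRe_nm.
  - by move=> z w; rewrite cImD cImN.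
  - exact: cIm_nm.
move=> rB rnm; pose g s := r (phi (u + vertical s)).
have dg (s : R) : 0 <= s -> is_derive s 1 g 0.
  move=> s0.
  have lim0 : (fun h => h^-1 *: ((g \o shift s) (h *: 1) - g s)) @ 0^' --> (0 : R).
    apply/cvgrPdist_le => e e0.
    have [d d0 hd] := zero_partials_littleo (h _ (upper_half_up hu s0)) e0.
    exists d => //= x /=; rewrite sub0r normrN => xd x0.
    rewrite sub0r normrN normrM normfV /g /shift /= rB.
    rewrite ler_pdivrMl ?normr_gt0//; apply: le_trans (rnm _) _.
    rewrite [_ *: 1]mulr1 mulrC [x + s]addrC vertical_add addrA; exact: hd.
  split; first by apply/cvg_ex; exists 0.
  exact: (cvg_lim _ lim0).
have gd x : x \in `]0, t[ -> is_derive x 1 g 0.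
  by rewrite in_itv /= => /andP[/ltW x0 _]; exact: dg.
have gc : {within `[0, t], continuous g}.
  apply: derivable_within_continuous => x; rewrite in_itv /= => /andP[x0 _].
  by case: (dg x x0).
have [c _] := MVT_segment t0 gd gc.
rewrite mul0r => /eqP; rewrite subr_eq0 => /eqP; rewrite /g => ->.
congr (r (phi _)); apply/rowP => j; rewrite !mxE.
by apply: complex_ext; rewrite ?cReD ?cImD /= addr0.
Qed.

End Partials.

(** * Exponentials of nilpotent endomorphisms *)

Section NilpotentExp.
Context {R : realType} {V : vectType (cplx R)}.
Local Notation C := (cplx R).
Implicit Types (f g : 'End(V)) (v w : V).

Lemma iter_lfun f k v : iter k f v = (iter k (fun g => f \o g)%VF \1%VF) v.
Proof. by elim: k => [|k IH] /=; rewrite ?id_lfunE// comp_lfunE -IH. Qed.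

Lemma iter_lfun0 f k : iter k f 0 = 0.
Proof. by elim: k => //= k ->; rewrite linear0. Qed.

(** The images of the iterates of [f] decrease strictly in dimension until they
    stabilize, and the stable value is [0]. *)
Lemma nilpotent_dim f v : nilpotent f -> iter (\dim {:V}) f v = 0.
Proof.
move=> [m hm]; pose U k := iter k (fun W : {vspace V} => (f @: W)%VS) fullv.
have U0 : U m = 0%VS.
  suff mem k w : w \in U k -> exists x, w = iter k f x.
    apply/eqP; rewrite -subv0; apply/subvP => w /mem[x ->].
    by rewrite hm mem0v.
  elim: k w => [|k IH] w; first by exists w.
  by move=> /memv_imgP[x /IH[y ->] ->]; exists y.
have Uv k w : iter k f w \in U k.
  by elim: k => [|k IH]; [exact: memvf|exact: memv_img].
have Udecr k : (U k.+1 <= U k)%VS.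
  elim: k => [|k IH]; [exact: subvf|exact: limgS].
have stable k : U k.+1 = U k -> U k = 0%VS.
  move=> e; have : forall i, U (i + k)%N = U k.
    elim=> // i IH; rewrite addSn -[in RHS]e -[in LHS]/(U (i + k).+1).
    by rewrite -[U (i + k).+1]/((f @: U (i + k)%N)%VS) IH.
  move=> /(_ m); rewrite addnC.
  suff -> : U (k + m)%N = 0%VS by [].
  by elim: k {e} => // k IH; rewrite addSn -[LHS]/((f @: U (k + m)%N)%VS) IH limg0.
have dimU k : U k = 0%VS \/ (\dim (U k) + k <= \dim {:V})%N.
  elim: k => [|k [e|IH]]; first by right; rewrite addn0.
  - by left; rewrite -[LHS]/((f @: U k)%VS) e limg0.
  - have [e|ne] := eqVneq (U k.+1) (U k).
      by left; rewrite e; exact: stable.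
    right; apply: leq_trans IH; rewrite addnS -addSn leq_add2r ltn_neqAle.
    rewrite dimvS // andbT; apply: contra ne => /eqP e.
    by rewrite -(geq_leqif (dimv_leqif_eq (Udecr k))) e.
have := Uv (\dim {:V}) v.
have [->|] := dimU (\dim {:V}); first by rewrite memv0 => /eqP.
rewrite -[leqRHS]add0n leq_add2r leqn0 dimv_eq0 => /eqP ->.
by rewrite memv0 => /eqP.
Qed.

Lemma iter_vanish f m k v : (forall w, iter m f w = 0) -> (m <= k)%N -> iter k f v = 0.
Proof. by move=> h /subnK <-; rewrite iterD h iter_lfun0. Qed.

Lemma sum_widen (F : nat -> V) m k : (m <= k)%N -> (forall i, (m <= i)%N -> F i = 0) ->
  \sum_(i < k) F i = \sum_(i < m) F i.
Proof.
move=> mk h; rewrite -(subnKC mk) big_split_ord /= [X in _ + X]big1 ?addr0// => i _.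
by rewrite h// leq_addr.
Qed.

(** The exponential may be truncated at any index annihilating [f], and not
    only at the dimension. *)
Lemma nexp_trunc f m v : (forall w, iter m f w = 0) ->
  nexp f v = \sum_(k < m) (k`!%:R : C)^-1 *: iter k f v.
Proof.
move=> hm; have nf : nilpotent f by exists m.
pose F k := (k`!%:R : C)^-1 *: iter k f v.
rewrite /nexp -[LHS]/(\sum_(k < (\dim {:V}).+1) F k) -[RHS]/(\sum_(k < m) F k).
have [h|h] := leqP m (\dim {:V}).+1.
  by apply: sum_widen => // i mi; rewrite /F (iter_vanish _ hm)// scaler0.
apply/esym/sum_widen; first exact: ltnW.
move=> i di; rewrite /F (@iter_vanish f (\dim {:V})) ?scaler0 ?(ltnW di)// => w.
exact: nilpotent_dim.
Qed.

Local Notation dimV := (\dim {:V}).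

(** The power series [(exp x - 1) / x] at [f]. *)
Definition expm1_div f v : V := \sum_(k < dimV) ((k.+1)`!%:R : C)^-1 *: iter k f v.

Lemma expm1_divB f v w : expm1_div f (v - w) = expm1_div f v - expm1_div f w.
Proof.
rewrite /expm1_div -sumrB; apply: eq_bigr => k _.
by rewrite !iter_lfun linearB scalerBr.
Qed.

Lemma nexpE f v : nexp f v = v + expm1_div f (f v).
Proof.
rewrite /nexp big_ord_recl /= fact0 invr1 scale1r; congr (_ + _).
by apply: eq_bigr => k _; rewrite -iterSr.
Qed.

Lemma expm1_div_comm (h : 'End(V)) f v : (forall w, h (f w) = f (h w)) ->
  h (expm1_div f v) = expm1_div f (h v).
Proof.
move=> hf; rewrite /expm1_div linear_sum; apply: eq_bigr => k _.
rewrite linearZ; congr (_ *: _); elim: (k : nat) => //= m IH.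
by rewrite hf IH.
Qed.

Lemma expm1_div_inj f w : nilpotent f -> expm1_div f w = 0 -> w = 0.
Proof.
move=> [m /(_ w)]; elim: m w => // m IH w; rewrite iterSr => hm Aw.
have fw : f w = 0.
  by apply: IH hm _; rewrite -(@expm1_div_comm f)// Aw linear0.
have [/eqP d0|d0] := eqVneq dimV 0%N.
  by move: d0; rewrite dimv_eq0 => /eqP d0; apply/eqP; rewrite -memv0 -d0 memvf.
move: Aw; rewrite /expm1_div; case: dimV d0 => // d _.
rewrite big_ord_recl big1 ?addr0 ?invr1 ?scale1r// => k _.
by rewrite lift0 iterSr fw iter_lfun0 scaler0.
Qed.

(** With [Z = exp f - 1 = exp g - 1], one shows [f = g] on [ker Z ^ k] by
    induction on [k]: both maps send [ker Z ^ k.+1] to [ker Z ^ k], where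
    [(exp x - 1) / x] takes the same injective value at [f] and at [g]. *)
Lemma nexp_inj f g : nilpotent f -> nilpotent g -> (forall v, nexp f v = nexp g v) ->
  f = g.
Proof.
move=> nf ng efg; pose Z v := expm1_div f (f v).
have Zg v : Z v = expm1_div g (g v).
  by apply: (@addrI _ v); rewrite -!nexpE.
have Zf_comm k v : iter k Z (f v) = f (iter k Z v).
  elim: k => //= k ->; by rewrite /Z [RHS]expm1_div_comm.
have Zg_comm k v : iter k Z (g v) = g (iter k Z v).
  elim: k => //= k ->; by rewrite !Zg [RHS]expm1_div_comm.
have ZA (h : 'End(V)) : (forall k v, iter k Z (h v) = h (iter k Z v)) ->
    forall k v, iter k Z (expm1_div h v) = expm1_div h (iter k Z v).
  have Zsum (I : Type) (r : seq I) (a : I -> C) (F : I -> V) :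
     Z (\sum_(i <- r) a i *: F i) = \sum_(i <- r) a i *: Z (F i).
    have lZ : linear Z.
      move=> a' x y; rewrite /Z /expm1_div scaler_sumr -big_split /=.
      apply: eq_bigr => i _; rewrite linearP !iter_lfun linearP scalerDr.
      by rewrite !scalerA mulrC.
    have Z0 : Z 0 = 0 by rewrite /Z linear0 /expm1_div big1// => i _; rewrite iter_lfun0 scaler0.
    by elim: r => [|i r IH]; rewrite ?big_nil ?big_cons// lZ IH.
  move=> hZ k v; elim: k => //= k ->; rewrite /expm1_div Zsum.
  apply: eq_bigr => i _; congr (_ *: _).
  have hZ1 w : Z (h w) = h (Z w) := hZ 1%N w.
  by elim: (i : nat) => //= m IH; rewrite hZ1 IH.
have key k : forall v, iter k Z v = 0 -> f v = g v.
  elim: k => [v /= ->|k IH v hv]; first by rewrite !linear0.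
  have kf : iter k Z (f v) = 0.
    apply: (expm1_div_inj nf); rewrite -(ZA f)//; by rewrite -/(Z v) -iterSr.
  have kg : iter k Z (g v) = 0.
    apply: (expm1_div_inj ng); rewrite -(ZA g)//; by rewrite -Zg -iterSr.
  have same : expm1_div g (g v) = expm1_div f (g v).
    apply: eq_bigr => i _; congr (_ *: _).
    suff [] : iter i g (g v) = iter i f (g v) /\ iter k Z (iter i f (g v)) = 0 by [].
    elim: (i : nat) => [|m [e1 e2]] /=; first by [].
    by rewrite e1 Zf_comm e2 linear0 (IH _ e2).
  apply/subr0_eq/(expm1_div_inj nf).
  by rewrite expm1_divB -same -Zg subrr.
apply/lfunP => v; have [m hm] := nf; apply: (key m).
suff -> : forall k w, iter k Z w = iter k (expm1_div f) (iter k f w).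
  rewrite hm; elim: m {hm} => //= m ->.
  by rewrite /expm1_div big1// => i _; rewrite iter_lfun0 scaler0.
elim=> // k IH w; rewrite iterSr IH.
have -> : iter k f (Z w) = expm1_div f (iter k f (f w)).
  rewrite /Z; elim: k {IH} => // k IH; by rewrite !iterS IH expm1_div_comm.
by rewrite -!iterSr.
Qed.

End NilpotentExp.

(** * The cohomology ring in coordinates dual to a basis of H^2 *)

Section HodgeRingTheory.
Context {R : realType} {H : hodge_ring R}.
Local Notation C := (cplx R).
Implicit Types (a b : H).

Lemma hproj_mem p a : hproj H p a \in hodge H p.
Proof. exact: memv_sum_pi. Qed.

Lemma hproj_sum a : \sum_(p < 4) hproj H p a = a.
Proof. by apply: sumv_pi_sum; rewrite hodge_full memvf. Qed.

Lemma hproj_unique (b : 'I_4 -> H) a p : (forall q : 'I_4, b q \in hodge H q) ->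
  \sum_(q < 4) b q = a -> hproj H p a = b p.
Proof.
move=> hb e.
have /directv_sum_unique h := hodge_direct H.
have := h (fun q => hproj H q a) b (fun q _ => hproj_mem q a) (fun q _ => hb q).
by rewrite e hproj_sum eqxx => /esym/forall_inP/(_ p isT)/eqP.
Qed.

Lemma hproj_id (p q : 'I_4) a : a \in hodge H p ->
  hproj H q a = if q == p then a else 0.
Proof.
move=> ha; apply: (@hproj_unique (fun q => if q == p then a else 0)).
  by move=> r; case: eqP => [->|_] //; exact: mem0v.
by rewrite -big_mkcond big_pred1_eq.
Qed.

Lemma integral_hodge p a : p != 3%N -> a \in hodge H p -> integral_X H a = 0.
Proof.
rewrite neq_ltn => /orP[|] p3 ha; first exact: integral_lt3 ha.
by move: ha; rewrite hodge_gt3// memv0 => /eqP ->; rewrite linear0.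
Qed.

Lemma cup_hodge p q r a b : a \in hodge H p -> b \in hodge H q -> (p + q)%N = r ->
  a * b \in hodge H r.
Proof. by move=> ha hb <-; exact: hodge_cup. Qed.

Lemma cup_gt3 p q a b : a \in hodge H p -> b \in hodge H q -> (3 < p + q)%N ->
  a * b = 0.
Proof.
by move=> ha hb pq; apply/eqP; rewrite -memv0 -(hodge_gt3 H pq); exact: hodge_cup.
Qed.

Lemma cupAC a b c : a * b * c = a * c * b :> H.
Proof. by rewrite -!mulrA (cup_comm b). Qed.

Lemma one_hodge : (1 : H) \in hodge H 0.
Proof. by rewrite hodge_0 memv_line. Qed.

(** The other components of [b] do not contribute, since the integral vanishes
    outside degree [3]. *)
Lemma poincare_complementary (p q : 'I_4) a : (p + q)%N = 3%N -> a \in hodge H p ->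
  (forall b, b \in hodge H q -> integral_X H (a * b) = 0) -> a = 0.
Proof.
move=> pq ha hb; apply: poincare_duality => b.
rewrite -(hproj_sum b) mulr_sumr linear_sum big1// => r _.
have [->|rq] := eqVneq r q; first exact/hb/hproj_mem.
apply: (@integral_hodge (p + r)%N); last exact: hodge_cup ha (hproj_mem _ _).
by apply: contra rq => /eqP e; apply/eqP/val_inj/(@addnI p); rewrite /= e pq.
Qed.

(** ** Endomorphisms raising the cohomological degree *)

(** Membership in the sum of the [H^{c,c}] with [c >= m], a filtration opposite
    to the Hodge filtration. *)
Definition high (m : nat) a : Prop := forall c : 'I_4, (c < m)%N -> hproj H c a = 0.

Lemma high_hodge (p : 'I_4) a : a \in hodge H p -> high p a.
Proof. by move=> ha c cp; rewrite (hproj_id _ ha); case: eqP cp => // ->; rewrite ltnn. Qed.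

Lemma highW m k a : high k a -> (m <= k)%N -> high m a.
Proof. by move=> h mk c cm; apply: h; exact: leq_trans cm mk. Qed.

Lemma highD m a b : high m a -> high m b -> high m (a + b).
Proof. by move=> ha hb c cm; rewrite linearD /= ha ?hb ?addr0. Qed.

Lemma highZ m (x : C) a : high m a -> high m (x *: a).
Proof. by move=> ha c cm; rewrite linearZ /= ha ?scaler0. Qed.

Lemma high_sum m (I : Type) (r : seq I) (P : pred I) (F : I -> H) :
  (forall i, P i -> high m (F i)) -> high m (\sum_(i <- r | P i) F i).
Proof. by move=> h c cm; rewrite linear_sum big1// => i Pi; exact: h. Qed.

Lemma degree_compE k (f : 'End(H)) a : degree_comp k f a =
  \sum_(p < 4) \sum_(q < 4 | (q : nat) == (p + k)%N) hproj H q (f (hproj H p a)).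
Proof.
rewrite /degree_comp sum_lfunE; apply: eq_bigr => p _.
by rewrite sum_lfunE; apply: eq_bigr => q _; rewrite !comp_lfunE.
Qed.

Lemma high_degree_comp m k (f : 'End(H)) a : high m a ->
  high (m + k)%N (degree_comp k f a).
Proof.
move=> ha; rewrite degree_compE; apply: high_sum => p _; apply: high_sum => q /eqP qpk c cmk.
rewrite (hproj_id _ (hproj_mem q _)); case: eqP => // cq.
have pm : (p < m)%N by move: cmk; rewrite cq qpk ltn_add2r.
by rewrite (ha p pm) !linear0.
Qed.

Definition degree_raising (f : 'End(H)) : Prop :=
  f = \sum_(1 <= k < 4) degree_comp k f.

Lemma high_raising m (f : 'End(H)) a : degree_raising f -> high m a -> high m.+1 (f a).
Proof.
move=> hf ha; rewrite hf sum_lfunE big_seq; apply: high_sum => k.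
rewrite mem_index_iota => /andP[k1 _]; apply: (highW (@high_degree_comp _ k f _ ha)).
by rewrite -addn1 leq_add2l.
Qed.

Lemma high_iter m k (f : 'End(H)) a : degree_raising f -> high m a ->
  high (m + k)%N (iter k f a).
Proof.
move=> hf ha; elim: k => [|k IH]; first by rewrite addn0.
by rewrite addnS iterS; exact: high_raising.
Qed.

Lemma high_nexp1 m (f : 'End(H)) a : degree_raising f -> high m a ->
  high m.+1 (nexp f a - a).
Proof.
move=> hf ha; rewrite nexpE addrC addKr; apply: high_sum => k _; apply: highZ.
apply: (highW (@high_iter _ k _ _ hf (high_raising hf ha))); exact: leq_addr.
Qed.

(** The exponential is [1 + f] up to terms raising the degree by two, so its
    first graded piece is that of [f]. *)
Lemma high_nexp2 m (f : 'End(H)) a : degree_raising f -> high m a ->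
  high m.+2 (nexp f a - a - f a).
Proof.
move=> hf ha; rewrite nexpE [a + _]addrC addrK /expm1_div.
have : (0 < \dim {:H})%N.
  rewrite lt0n dimv_eq0; apply/negP => /eqP e.
  by have := memvf (1 : H); rewrite e memv0 oner_eq0.
case: (\dim _) => // d _; rewrite big_ord_recl invr1 scale1r addrC addKr.
apply: high_sum => k _; apply: highZ.
apply: (highW (@high_iter _ (lift ord0 k) _ _ hf (high_raising hf ha))).
by rewrite lift0 addnS ltnS leq_addr.
Qed.

Lemma mem_filtration (p : 'I_4) a : a \in hodge H p -> a \in hodge_filtration H (3 - p).
Proof.
move=> ha; rewrite /hodge_filtration; apply: subvP ha; apply: sumv_sup (subvv _).
by rewrite subnKC// -ltnS.
Qed.

Lemma filtration_hproj (p c : 'I_4) a : a \in hodge_filtration H (3 - p) -> (p < c)%N ->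
  hproj H c a = 0.
Proof.
move=> /memv_sumP[v hv ->] pc; rewrite linear_sum big1// => q q3.
rewrite /= (hproj_id _ (hv q q3)); case: eqP => // e.
move: q3; rewrite -e => h; have p3 : (p <= 3)%N by rewrite -ltnS.
have : (c + (3 - p) <= p + (3 - p))%N by rewrite [leqRHS]subnKC.
by rewrite leq_add2r leqNgt pc.
Qed.

(** The two filtrations are opposite: if a map preserves the Hodge filtration
    and is unipotent for [high], then its difference with the identity
    vanishes on each [H^{p,p}] by this lemma. *)
Lemma filtration_high_eq0 (p : 'I_4) a : a \in hodge_filtration H (3 - p) ->
  high p.+1 a -> a = 0.
Proof.
move=> fa ha; rewrite -(hproj_sum a) big1// => c _.
by have [cp|pc] := leqP c p; [exact: ha|exact: filtration_hproj fa pc].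
Qed.

(** ** Coordinates and intersection numbers *)

Section Coordinates.
Context {n : nat} (T D : n.-tuple H) (j0 : 'I_n).
Hypothesis T_basis : basis_of (hodge H 1) T.
Hypothesis D_dual : is_dual_basis T D.
Implicit Types (j k l : 'I_n).

Lemma T_hodge k : tnth T k \in hodge H 1.
Proof. exact: (basis_mem T_basis (mem_tnth k T)). Qed.

Lemma D_hodge k : tnth D k \in hodge H 2.
Proof. by case: (D_dual k). Qed.

Lemma integral_TD k l : integral_X H (tnth T k * tnth D l) = (k == l)%:R.
Proof. by case: (D_dual l) => _ ->. Qed.

(** The class of a point. *)
Definition pt : H := tnth T j0 * tnth D j0.

Lemma pt_hodge : pt \in hodge H 3.
Proof. exact: cup_hodge (T_hodge j0) (D_hodge j0) erefl. Qed.

Lemma integral_pt : integral_X H pt = 1.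
Proof. by rewrite integral_TD eqxx. Qed.

Lemma hodge3_pt a : a \in hodge H 3 -> a = integral_X H a *: pt.
Proof.
move=> ha; apply/subr0_eq/(@poincare_complementary (inord 3) (inord 0)).
- by rewrite !inordK.
- by rewrite inordK// memvB// memvZ// pt_hodge.
move=> b; rewrite inordK// hodge_0 => /vlineP[c ->].
by rewrite -scalerAr mulr1 linearZ /= linearB linearZ /= integral_pt mulr1 subrr mulr0.
Qed.

Lemma cup_TD k l : tnth T k * tnth D l = (k == l)%:R *: pt.
Proof.
rewrite [LHS]hodge3_pt ?integral_TD//.
exact: cup_hodge (T_hodge k) (D_hodge l) erefl.
Qed.

Lemma hodge2_D a : a \in hodge H 2 ->
  a = \sum_l integral_X H (a * tnth T l) *: tnth D l.
Proof.
move=> ha; apply/subr0_eq/(@poincare_complementary (inord 2) (inord 1)).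
- by rewrite !inordK.
- rewrite inordK// memvB// memv_suml// => l _; rewrite memvZ//; exact: D_hodge.
move=> b; rewrite inordK// => /(coord_basis T_basis) ->.
rewrite mulr_sumr linear_sum big1// => k _.
rewrite -scalerAr linearZ /= mulrBl linearB /= -tnth_nth.
rewrite mulr_suml linear_sum (bigD1 k)//= [\sum_(i < n | _) _]big1 => [|l lk].
  rewrite -scalerAl linearZ /= (cup_comm (tnth D k)) integral_TD eqxx mulr1.
  by rewrite addr0 subrr mulr0.
by rewrite -scalerAl linearZ /= (cup_comm (tnth D l)) integral_TD eq_sym (negbTE lk) mulr0.
Qed.

(** Pairing with the dual basis gives the coordinates with respect to [1], the
    [T_k], the [T_k^vee] and [pt]. *)
Definition co0 a : C := integral_X H (a * pt).
Definition co1 k a : C := integral_X H (a * tnth D k).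
Definition co2 l a : C := integral_X H (a * tnth T l).
Definition co3 a : C := integral_X H a.

Lemma co0_scalar : scalar co0.
Proof. by move=> c a b; rewrite /co0 mulrDl -scalerAl linearP. Qed.
Lemma co1_scalar k : scalar (co1 k).
Proof. by move=> c a b; rewrite /co1 mulrDl -scalerAl linearP. Qed.
Lemma co2_scalar k : scalar (co2 k).
Proof. by move=> c a b; rewrite /co2 mulrDl -scalerAl linearP. Qed.
Lemma co3_scalar : scalar co3.
Proof. by move=> c a b; rewrite /co3 linearP. Qed.

Lemma coordT_co1 k a : a \in hodge H 1 -> coord T k a = co1 k a.
Proof.
move=> ha; rewrite /co1 {2}(coord_basis T_basis ha) mulr_suml linear_sum (bigD1 k)//=.
rewrite big1 ?addr0 => [|l lk]; rewrite -scalerAl linearZ /= -tnth_nth integral_TD.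
  by rewrite eqxx mulr1.
by rewrite (negbTE lk) mulr0.
Qed.

Lemma hodge1_T a : a \in hodge H 1 -> a = \sum_k co1 k a *: tnth T k.
Proof.
move=> ha; rewrite [LHS](coord_basis T_basis ha); apply: eq_bigr => k _.
by rewrite coordT_co1// -tnth_nth.
Qed.

Lemma integral_hproj (p q : 'I_4) a b : (p + q)%N = 3%N -> b \in hodge H q ->
  integral_X H (hproj H p a * b) = integral_X H (a * b).
Proof.
move=> pq hb; rewrite -[in RHS](hproj_sum a) mulr_suml linear_sum (bigD1 p)//=.
rewrite big1 ?addr0// => r rp.
apply: (@integral_hodge (r + q)%N); last exact: hodge_cup (hproj_mem _ _) hb.
by apply: contra rp => /eqP e; apply/eqP/val_inj/(@addIn q); rewrite /= e pq.
Qed.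

Lemma coordT_hproj k a : coord T k (hproj H (inord 1) a) = co1 k a.
Proof.
rewrite coordT_co1; last by have := hproj_mem (inord 1) a; rewrite inordK.
apply: (@integral_hproj _ (inord 2)); rewrite !inordK//; exact: D_hodge.
Qed.

Lemma hproj2E a : hproj H (inord 2) a = \sum_l co2 l a *: tnth D l.
Proof.
rewrite [LHS]hodge2_D; last by have := hproj_mem (inord 2) a; rewrite inordK.
apply: eq_bigr => k _; congr (_ *: _).
by apply: (@integral_hproj _ (inord 1)); rewrite !inordK//; exact: T_hodge.
Qed.

Lemma coE a : a = co0 a *: 1 + \sum_k co1 k a *: tnth T k
   + \sum_l co2 l a *: tnth D l + co3 a *: pt.
Proof.
rewrite -[LHS](hproj_sum a) !big_ord_recr big_ord0 /= add0r.
congr (_ + _ + _ + _).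
- have := hproj_mem (inord 0) a; rewrite inordK// hodge_0 => /vlineP[c e].
  rewrite (_ : widen_ord _ _ = inord 0); last by apply: val_inj; rewrite /= inordK.
  rewrite e; congr (_ *: _).
  rewrite /co0 -(@integral_hproj (inord 0) (inord 3)) ?inordK ?pt_hodge//.
  by rewrite e -scalerAl mul1r linearZ /= integral_pt mulr1.
- rewrite (_ : widen_ord _ _ = inord 1); last by apply: val_inj; rewrite /= inordK.
  rewrite [LHS]hodge1_T; last by have := hproj_mem (inord 1) a; rewrite inordK.
  apply: eq_bigr => k _; congr (_ *: _).
  by apply: (@integral_hproj _ (inord 2)); rewrite !inordK//; exact: D_hodge.
- rewrite (_ : widen_ord _ _ = inord 2); last by apply: val_inj; rewrite /= inordK.
  exact: hproj2E.
- rewrite (_ : ord_max = inord 3); last by apply: val_inj; rewrite /= inordK.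
  rewrite [LHS]hodge3_pt; last by have := hproj_mem (inord 3) a; rewrite inordK.
  congr (_ *: _); rewrite -[hproj _ _ _]mulr1 -[in RHS](mulr1 a).
  by apply: (@integral_hproj _ (inord 0)); rewrite !inordK//; exact: one_hodge.
Qed.

Lemma co_ext a b : co0 a = co0 b -> (forall k, co1 k a = co1 k b) ->
  (forall l, co2 l a = co2 l b) -> co3 a = co3 b -> a = b.
Proof.
move=> e0 e1 e2 e3; rewrite (coE a) (coE b) e0 e3.
by under eq_bigr do rewrite e1; under [in X in _ + X + _]eq_bigr do rewrite e2.
Qed.

Lemma co_one : [/\ co0 1 = 1, forall k, co1 k 1 = 0, forall l, co2 l 1 = 0 & co3 1 = 0].
Proof.
split=> [|k|l|]; rewrite /co0 /co1 /co2 /co3 ?mul1r.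
- exact: integral_pt.
- exact: integral_hodge (D_hodge k).
- exact: integral_hodge (T_hodge l).
- exact: integral_hodge one_hodge.
Qed.

Lemma co_T j : [/\ co0 (tnth T j) = 0, forall k, co1 k (tnth T j) = (j == k)%:R,
  forall l, co2 l (tnth T j) = 0 & co3 (tnth T j) = 0].
Proof.
split=> [|k|l|]; rewrite /co0 /co1 /co2 /co3.
- by rewrite (cup_gt3 (T_hodge j) pt_hodge)// linear0.
- exact: integral_TD.
- exact: integral_hodge (cup_hodge (T_hodge j) (T_hodge l) erefl).
- exact: integral_hodge (T_hodge j).
Qed.

Lemma co_D j : [/\ co0 (tnth D j) = 0, forall k, co1 k (tnth D j) = 0,
  forall l, co2 l (tnth D j) = (j == l)%:R & co3 (tnth D j) = 0].
Proof.
split=> [|k|l|]; rewrite /co0 /co1 /co2 /co3.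
- by rewrite (cup_gt3 (D_hodge j) pt_hodge)// linear0.
- by rewrite (cup_gt3 (D_hodge j) (D_hodge k))// linear0.
- by rewrite cup_comm integral_TD eq_sym.
- exact: integral_hodge (D_hodge j).
Qed.

Lemma co_pt : [/\ co0 pt = 0, forall k, co1 k pt = 0, forall l, co2 l pt = 0 & co3 pt = 1].
Proof.
split=> [|k|l|]; rewrite /co0 /co1 /co2 /co3.
- by rewrite (cup_gt3 pt_hodge pt_hodge)// linear0.
- by rewrite (cup_gt3 pt_hodge (D_hodge k))// linear0.
- by rewrite (cup_gt3 pt_hodge (T_hodge l))// linear0.
- exact: integral_pt.
Qed.

(** The triple intersection numbers. *)
Definition kappa j k l : C := integral_X H (tnth T j * tnth T k * tnth T l).

(** In coordinates, cup product with [T_j] is given by the triple intersection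
    numbers alone. *)
Lemma co_cup j a : [/\ co0 (tnth T j * a) = 0,
  forall k, co1 k (tnth T j * a) = (j == k)%:R * co0 a,
  forall l, co2 l (tnth T j * a) = \sum_k co1 k a * kappa j k l
  & co3 (tnth T j * a) = co2 j a].
Proof.
split=> [|k|l|]; rewrite /co0 /co1 /co2 /co3.
- by rewrite cupAC (cup_gt3 (T_hodge j) pt_hodge)// mul0r linear0.
- by rewrite cupAC cup_TD cup_comm -scalerAr linearZ.
- have h2 : tnth T j * tnth T l \in hodge H 2.
    exact: cup_hodge (T_hodge j) (T_hodge l) erefl.
  rewrite cupAC cup_comm {1}(hodge2_D h2) mulr_sumr linear_sum; apply: eq_bigr => k _.
  by rewrite -scalerAr linearZ /= mulrC /kappa cupAC.
- by rewrite cup_comm.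
Qed.

End Coordinates.
End HodgeRingTheory.

(** * Calculus for the coordinates q and for algebra-valued maps *)

Section QMap.
Context {R : realType} {n : nat}.
Local Notation C := (cplx R).
Implicit Types (u v : 'rV[C]_n).

Lemma qmapE u j : qmap u 0 j = cexp (twopii R * u 0 j).
Proof. by rewrite mxE. Qed.

Lemma cRe_twopii (z : C) : cRe (twopii R * z) = - (2 * pi * cIm z).
Proof. by rewrite cReM /= mul0r sub0r. Qed.

Lemma qmap_polydisc u : upper_half u -> polydisc (qmap u).
Proof.
move=> hu j; rewrite qmapE -nmE nm_cexp -ofR1 ofR_lt cRe_twopii expR_lt1.
by rewrite oppr_lt0 mulr_gt0 ?hu// mulr_gt0// pi_gt0.
Qed.

Lemma qmap_vertical u (t : R) :
  qmap (u + vertical t) = ofR (expR (- (2 * pi * t))) *: qmap u.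
Proof.
apply/rowP => j; rewrite [in RHS]mxE !qmapE !mxE mulrDr cexpD mulrC; congr (_ * _).
rewrite /cexp cRe_twopii cImM /= !mul0r mulr0 addr0 cos0 sin0.
by rewrite -[Complex 1 0]/(1 : C) mulr1.
Qed.

Lemma qmap_diff u : differentiable (@qmap R n) u.
Proof.
have dj j : differentiable (fun v => qmap v 0 j) u.
  pose a i : C := (i == j)%:R * (twopii R * qmap u 0 j).
  have := @is_diff_quadratic _ _ (fun v => qmap v 0 j) u a
    (nm (qmap u 0 j) * (4 * (2 * pi) ^+ 2 * expR (2 * pi))) 1 ltr01.
  case=> // v v1.
  have linE : linform a v = (twopii R * v 0 j) * qmap u 0 j.
    rewrite /linform (bigD1 j)//= /a eqxx mul1r big1 ?addr0 => [|i /negbTE ->].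
      by ring.
    by rewrite mul0r mulr0.
  have -> : qmap (v + u) 0 j - qmap u 0 j - linform a v =
      qmap u 0 j * (cexp (twopii R * v 0 j) - 1 - twopii R * v 0 j).
    by rewrite linE !qmapE mxE mulrDr cexpD; ring.
  rewrite nmM -mulrA; apply: ler_wpM2l; first exact: nm_ge0.
  apply: le_trans (cexp_quadratic _) _.
  have p0 : 0 <= 2 * pi :> R by rewrite mulr_ge0// pi_ge0.
  have zv : nm (twopii R * v 0 j) <= 2 * pi * nm v.
    rewrite nmM /twopii nm_complex expr0n /= add0r sqrtr_sqr ger0_norm//.
    by apply: ler_wpM2l => //; exact: nm_coord.
  have -> : 4 * (2 * pi) ^+ 2 * expR (2 * pi) * nm v ^+ 2 =
     4 * (2 * pi * nm v) ^+ 2 * expR (2 * pi) :> R by ring.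
  apply: ler_pM; rewrite ?expR_ge0 ?mulr_ge0 ?exprn_ge0 ?nm_ge0//.
    apply: ler_wpM2l => //; apply: lerXn2r => //; rewrite nnegrE ?nm_ge0//.
    by rewrite mulr_ge0// nm_ge0.
  rewrite ler_expR; apply: le_trans zv _; rewrite -[leRHS]mulr1.
  by apply: ler_wpM2l => //; exact: ltW.
have -> : @qmap R n = \sum_j (fun v => qmap v 0 j *: delta_mx 0 j).
  apply/funext => v; rewrite fct_sumE [LHS]row_sum_delta; exact: eq_bigr.
by apply: differentiable_sum => j; apply: differentiableZl.
Qed.

Lemma qmap_continuous u : {for u, continuous (@qmap R n)}.
Proof. exact/differentiable_continuous/qmap_diff. Qed.

Lemma expR_decay : (fun m : nat => expR (- (2 * pi * m%:R)) : R) @ \oo --> (0 : R).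
Proof.
apply/cvgrPdist_lt => e e0; near=> m.
rewrite sub0r normrN ger0_norm ?expR_ge0// expRN invf_plt ?posrE ?expR_gt0//.
have h := expR_ge1Dx (2 * pi * m%:R : R).
have p1 : 1 <= 2 * pi :> R by have := pi_ge2 R; lra.
have m0 : 0 <= m%:R :> R by rewrite ler0n.
have m1 : e^-1 < m%:R by near: m; exact: nbhs_infty_gtr.
apply: lt_le_trans m1 _; apply: le_trans h.
by have := ler_pM ler01 m0 p1 (lexx m%:R); rewrite mul1r; lra.
Unshelve. all: by end_near. Qed.

Lemma qmap_vertical_cvg u :
  (fun m : nat => qmap (u + vertical m%:R)) @ \oo --> (0 : 'rV[C]_n).
Proof.
apply: cvg_nm => e e0; have K0 : 0 < nm (qmap u) + 1 by rewrite ltr_wpDl// nm_ge0.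
have /cvgrPdist_lt/(_ (e / (nm (qmap u) + 1))) := expR_decay.
rewrite divr_gt0// => /(_ isT); apply: filterS => m.
rewrite sub0r normrN ger0_norm ?expR_ge0// subr0 qmap_vertical nmZ nm_ofR.
rewrite ger0_norm ?expR_ge0// ltr_pdivlMr// => h.
by apply: le_lt_trans h; apply: ler_wpM2l; rewrite ?expR_ge0// lerDl.
Qed.

(** Along these sequences the coordinates [q] tend to [0]. *)
Definition vanishes (phi : 'rV[C]_n -> C) : Prop := forall u, upper_half u ->
  (fun m : nat => phi (u + vertical m%:R)) @ \oo --> (0 : C).

Lemma vanishes_exp_bound (phi : 'rV[C]_n -> C) :
  (forall u, upper_half u -> exists M, forall t, 0 <= t ->
    nm (phi (u + vertical t)) <= M * expR (- (2 * pi * t))) -> vanishes phi.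
Proof.
move=> h u /h[M hM]; apply: cvg_nm => e e0.
have K0 : 0 < `|M| + 1 by rewrite ltr_wpDl.
have /cvgrPdist_lt/(_ (e / (`|M| + 1))) := expR_decay.
rewrite divr_gt0// => /(_ isT); apply: filterS => m.
rewrite sub0r normrN ger0_norm ?expR_ge0// subr0 ltr_pdivlMr// mulrC => he.
apply: le_lt_trans he; apply: le_trans (hM _ (ler0n _ _)) _.
by rewrite ler_wpM2r ?expR_ge0//; have := ler_norm M; lra.
Qed.

End QMap.

Section SequenceLimits.
Context {R : realType}.
Local Notation C := (cplx R).
Implicit Types (f g : nat -> C) (a b : C).

Lemma cvg_addn f g a b : f @ \oo --> a -> g @ \oo --> b ->
  (fun m => f m + g m) @ \oo --> a + b.
Proof. move=> hf hg. exact: (cvgD hf hg). Qed.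

Lemma cvg_muln f g a b : f @ \oo --> a -> g @ \oo --> b ->
  (fun m => f m * g m) @ \oo --> a * b.
Proof. move=> hf hg. exact: (cvgM hf hg). Qed.

Lemma cvg_subn f g a b : f @ \oo --> a -> g @ \oo --> b ->
  (fun m => f m - g m) @ \oo --> a - b.
Proof. move=> hf hg. exact: (cvgB hf hg). Qed.
Lemma cvg_sum_nat (J : Type) (r : seq J) (f : J -> nat -> C) (c : J -> C) :
  (forall i, f i @ \oo --> c i) ->
  (fun m => \sum_(i <- r) f i m) @ \oo --> \sum_(i <- r) c i.
Proof.
move=> h; elim: r => [|i r IH].
  rewrite big_nil (_ : (fun _ => _) = cst 0); first exact: cvg_cst.
  by apply/funext => m; rewrite big_nil.
rewrite big_cons (_ : (fun _ => _) = (fun m => f i m + \sum_(i <- r) f i m)).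
  exact: (cvg_addn (h i) IH).
by apply/funext => m; rewrite big_cons.
Qed.
End SequenceLimits.

Section AlgebraValued.
Context {R : realType} {n : nat} {A : falgType (cplx R)}.
Local Notation C := (cplx R).
Implicit Types (f g : 'rV[C]_n -> A) (u : 'rV[C]_n).

Lemma has_partials_lin (V W : vectType C) (L : V -> W) (f : 'rV[C]_n -> V) u
    (d : 'I_n -> V) : linear L -> has_partials f u d ->
  has_partials (fun x => L (f x)) u (fun j => L (d j)).
Proof. by move=> hL hf l hl; apply: (hf (l \o L)) => a x y /=; rewrite hL hl. Qed.

Lemma has_partials_cst (V : vectType C) (v : V) u : has_partials (fun=> v) u (fun=> 0).
Proof.
move=> l hl; apply: scalar_partials_eq (scalar_partials_cst (l v) u) => j /=.
by rewrite (scalar_form0 hl).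
Qed.

Lemma has_partialsD (V : vectType C) (f g : 'rV[C]_n -> V) u (d e : 'I_n -> V) :
  has_partials f u d -> has_partials g u e ->
  has_partials (fun x => f x + g x) u (fun j => d j + e j).
Proof.
move=> hf hg l hl; have lD := scalar_formD hl.
have -> : l \o (fun x => f x + g x) = fun x => (l \o f) x + (l \o g) x.
  by apply/funext => x /=; rewrite lD.
apply: scalar_partials_eq (scalar_partialsD (hf l hl) (hg l hl)) => j /=.
by rewrite lD.
Qed.

Lemma has_partialsM f g u (d e : 'I_n -> A) :
  has_partials f u d -> has_partials g u e ->
  has_partials (fun x => f x * g x) u (fun j => d j * g u + f u * e j).
Proof.
move=> hf hg l hl; pose b := vbasis {:A}.
have expand x y : l (x * y) = \sum_i \sum_k (coord b i x * coord b k y) * l (b`_i * b`_k).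
  rewrite {1}(coord_vbasis (memvf x)) {1}(coord_vbasis (memvf y)) mulr_suml.
  have lS (J : Type) (r : seq J) (F : J -> A) : l (\sum_(i <- r) F i) = \sum_(i <- r) l (F i).
    have := @scalar_form_sum _ _ l hl J r (fun=> 1) F.
    by under eq_bigr do rewrite scale1r; under [RHS]eq_bigr do rewrite mul1r.
  rewrite lS; apply: eq_bigr => i _; rewrite mulr_sumr lS; apply: eq_bigr => k _.
  rewrite -scalerAl -scalerAr scalerA.
  by have := @scalar_form_sum _ _ l hl _ [:: tt] (fun=> coord b i x * coord b k y)
    (fun=> b`_i * b`_k); rewrite !big_seq1.
have sc i : scalar (coord b i : A -> C) by move=> a x y; rewrite linearP.
have -> : l \o (fun x => f x * g x) = fun x =>
   \sum_(i < \dim {:A}) \sum_(k < \dim {:A})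
     l (b`_i * b`_k) * (coord b i (f x) * coord b k (g x)).
  apply/funext => x; rewrite /= expand; apply: eq_bigr => i _; apply: eq_bigr => k _.
  by rewrite mulrC.
have hp (i k : 'I_(\dim {:A})) := scalar_partialsZ (l (b`_i * b`_k))
  (scalar_partialsM (hf _ (sc i)) (hg _ (sc k))).
apply: scalar_partials_eq (scalar_partials_sum _ (fun i => scalar_partials_sum _ (hp i))).
move=> j /=; rewrite (scalar_formD hl) !expand -big_split; apply: eq_bigr => i _ /=.
rewrite -big_split; apply: eq_bigr => k _ /=; rewrite -mulrDl mulrC.
by [].
Qed.

End AlgebraValued.

(** * The exponential of a class in H^2 *)

(** [1 - x + x^2 / 2 - x^3 / 6], that is [exp (- x)] in a graded ring
    concentrated in degrees at most [3]. *)
Definition texp {R : realType} {A : falgType (cplx R)} (x : A) : A :=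
  1 - x + (2%:R^-1 : cplx R) *: x ^+ 2 - (6%:R^-1 : cplx R) *: x ^+ 3.

(** Once [3! s = 1], the two sides differ by multiples of monomials of degree
    at least four. *)
Lemma texp_com (A : comPzRingType) (s x y : A) : 6%:R * s = 1 ->
  x ^+ 3 * y = 0 -> x ^+ 2 * y ^+ 2 = 0 -> x * y ^+ 3 = 0 ->
  1 - (x + y) + 3%:R * s * (x + y) ^+ 2 - s * (x + y) ^+ 3 =
  (1 - x + 3%:R * s * x ^+ 2 - s * x ^+ 3) * (1 - y + 3%:R * s * y ^+ 2 - s * y ^+ 3).
Proof.
move=> s6 e1 e2 e3.
have -> : (1 - x + 3%:R * s * x ^+ 2 - s * x ^+ 3) *
    (1 - y + 3%:R * s * y ^+ 2 - s * y ^+ 3) =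
  (1 - (x + y) + 3%:R * s * (x + y) ^+ 2 - s * (x + y) ^+ 3)
  + (1 - 6%:R * s) * (x * y) + s * (x ^+ 3 * y) + s * (x * y ^+ 3)
  + 9%:R * s ^+ 2 * (x ^+ 2 * y ^+ 2)
  - 3%:R * s ^+ 2 * (x ^+ 2 * y ^+ 2) * y - 3%:R * s ^+ 2 * (x ^+ 2 * y ^+ 2) * x
  + s ^+ 2 * (x ^+ 3 * y) * y ^+ 2 by ring.
by rewrite s6 e1 e2 e3 subrr !(mulr0, mul0r) !(addr0, subr0).
Qed.

(** A copy of the ring carrying commutativity as part of its structure, so that
    polynomial identities apply to cohomology classes. *)
Definition comm_coh {R : realType} (H : hodge_ring R) : Type := coh H.
HB.instance Definition _ (R : realType) (H : hodge_ring R) := Falgebra.on (comm_coh H).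
HB.instance Definition _ (R : realType) (H : hodge_ring R) :=
  GRing.PzRing_hasCommutativeMul.Build (comm_coh H) (@cup_comm R H).

Section Texp.
Context {R : realType} {H : hodge_ring R}.
Local Notation C := (cplx R).
Implicit Types (x y : H).

Lemma hodge_exp p x : x \in hodge H 1 -> x ^+ p \in hodge H p.
Proof.
move=> hx; elim: p => [|p IH]; first exact: one_hodge.
by rewrite exprS; exact: cup_hodge hx IH erefl.
Qed.

Lemma texpD x y : x \in hodge H 1 -> y \in hodge H 1 ->
  texp (x + y) = texp x * texp y.
Proof.
move=> hx hy.
pose s : H := (6%:R^-1 : C) *: 1.
have s6 : 6%:R * s = 1.
  by rewrite mulr_natl /s -scaler_nat scalerA mulfV ?scale1r// pnatr_eq0.
have s1 z : s * z = (6%:R^-1 : C) *: z by rewrite /s -scalerAl mul1r.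
have s3 z : 3%:R * s * z = (2%:R^-1 : C) *: z.
  rewrite -mulrA s1 mulr_natl -scaler_nat scalerA; congr (_ *: _).
  by field.
have := @texp_com (comm_coh H) s x y s6.
have e1 : x ^+ 3 * y = 0 by apply: (cup_gt3 (hodge_exp 3 hx) hy).
have e2 : x ^+ 2 * y ^+ 2 = 0 by apply: (cup_gt3 (hodge_exp 2 hx) (hodge_exp 2 hy)).
have e3 : x * y ^+ 3 = 0 by apply: (cup_gt3 hx (hodge_exp 3 hy)).
move=> /(_ e1 e2 e3) h; rewrite /texp -!s3 -!s1; exact: h.
Qed.

Lemma texp0 : texp (0 : H) = 1.
Proof. by rewrite /texp !expr0n /= !scaler0 !subr0 addr0. Qed.

Lemma texpNK x : x \in hodge H 1 -> texp x * texp (- x) = 1.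
Proof. by move=> hx; rewrite -texpD ?memvN// subrr texp0. Qed.

End Texp.

(** * Flat sections of the Dubrovin connection *)

Section Variation.
Context {R : realType} {X : cy3 R} {n : nat} (T D : n.-tuple X) (j0 : 'I_n).
Local Notation C := (cplx R).
Local Notation H := (coh X).
Hypothesis T_basis : basis_of (hodge X 1) T.
Hypothesis D_dual : is_dual_basis T D.
Implicit Types (u : 'rV[C]_n) (a b : H) (j k l : 'I_n).

(** [h0] is the holomorphic part of the potential; [h1], [h2], [h3] are its
    partial derivatives. *)
Variables (h0 : 'rV[C]_n -> C) (h1 : 'I_n -> 'rV[C]_n -> C)
  (h2 : 'I_n -> 'I_n -> 'rV[C]_n -> C) (h3 : 'I_n -> 'I_n -> 'I_n -> 'rV[C]_n -> C).
Hypothesis h0_partials : forall u, upper_half u ->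
  scalar_partials h0 u (fun j => h1 j u).
Hypothesis h1_partials : forall k u, upper_half u ->
  scalar_partials (h1 k) u (fun j => h2 j k u).
Hypothesis h2_partials : forall k l u, upper_half u ->
  scalar_partials (h2 k l) u (fun j => h3 j k l u).
Hypothesis h2_sym : forall k l u, h2 k l u = h2 l k u.
Hypothesis h0_periodic : forall j u, h0 (u + delta_mx 0 j) = h0 u.
Hypothesis h1_periodic : forall k j u, h1 k (u + delta_mx 0 j) = h1 k u.
Hypothesis h2_periodic : forall k l j u, h2 k l (u + delta_mx 0 j) = h2 k l u.
Hypothesis h0_vanishes : vanishes h0.
Hypothesis h1_vanishes : forall k, vanishes (h1 k).
Hypothesis h2_vanishes : forall k l, vanishes (h2 k l).
Hypothesis dPhi3E : forall j k l u, upper_half u ->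
  dPhi3 T j k l u = kappa T j k l + h3 j k l u.

Local Notation pt := (pt T D j0).
Local Notation co0 := (co0 T D j0).
Local Notation co1 := (co1 D).
Local Notation co2 := (co2 T).
Local Notation co3 := (@co3 R X).
Local Notation co0_scalar := (co0_scalar T D j0).
Local Notation co1_scalar := (co1_scalar D).
Local Notation co2_scalar := (co2_scalar T).
Local Notation co3_scalar := (@co3_scalar R X).
Local Notation co_ext := (co_ext (j0 := j0) T_basis D_dual).
Local Notation co_T := (co_T j0 T_basis D_dual).
Local Notation co_D := (co_D j0 T_basis D_dual).

Definition co_comb (c0 : C) (c1 c2 : 'I_n -> C) (c3 : C) : H :=
  c0 *: 1 + \sum_k c1 k *: tnth T k + \sum_l c2 l *: tnth D l + c3 *: pt.

Lemma sum_mul_delta (c : 'I_n -> C) k : \sum_j c j * (j == k)%:R = c k.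
Proof.
rewrite (bigD1 k)//= eqxx mulr1 big1 ?addr0// => j /negbTE ->.
by rewrite mulr0.
Qed.

Lemma co_combE c0 c1 c2 c3 :
  [/\ co0 (co_comb c0 c1 c2 c3) = c0, forall k, co1 k (co_comb c0 c1 c2 c3) = c1 k,
      forall l, co2 l (co_comb c0 c1 c2 c3) = c2 l & co3 (co_comb c0 c1 c2 c3) = c3].
Proof.
have [q0 q1 q2 q3] := co_one j0 T_basis D_dual.
have [p0 p1 p2 p3] := co_pt j0 T_basis D_dual.
have zero (I : Type) (r : seq I) (F : I -> C) (G : I -> C) :
  (forall i, G i = 0) -> \sum_(i <- r) F i * G i = 0.
  by move=> h; rewrite big1// => i _; rewrite h mulr0.
split=> [|m|m|]; rewrite /co_comb.
- have hl := co0_scalar; rewrite !(scalar_formD hl) !(scalar_form_sum hl) !(scalar_formZ hl).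
  rewrite q0 p0 zero ?zero ?mulr1 ?mulr0 ?addr0// => i;
    by have [? _ _ ?] := co_T i; have [? _ _ ?] := co_D i.
- have hl := co1_scalar m; rewrite !(scalar_formD hl) !(scalar_form_sum hl) !(scalar_formZ hl).
  rewrite q1 p1 [X in _ + X + _]zero; last by move=> i; have [] := co_D i.
  rewrite mulr0 mulr0 add0r !addr0 -[RHS]sum_mul_delta; apply: eq_bigr => i _.
  by have [_ -> _ _] := co_T i.
- have hl := co2_scalar m; rewrite !(scalar_formD hl) !(scalar_form_sum hl) !(scalar_formZ hl).
  rewrite q2 p2 [X in _ + X + _ + _]zero; last by move=> i; have [] := co_T i.
  rewrite !mulr0 !add0r !addr0 -[RHS]sum_mul_delta; apply: eq_bigr => i _.
  by have [_ _ -> _] := co_D i.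
- have hl := co3_scalar; rewrite !(scalar_formD hl) !(scalar_form_sum hl) !(scalar_formZ hl).
  rewrite q3 p3 zero ?zero ?mulr1 ?mulr0 ?add0r// => i;
    by have [? _ _ ?] := co_T i; have [? _ _ ?] := co_D i.
Qed.

(** The nilpotent part of the fundamental solution: it sends [1] to
    [- sum_l h_l T_l^vee + 2 h pt] and [T_k] to [- sum_l h_kl T_l^vee + h_k pt],
    and kills the other basis vectors. Its square is zero, so that
    [exp (- corr) = 1 - corr]. *)
Definition corr u b : H := locked co_comb 0 (fun=> 0)
  (fun l => - (co0 b * h1 l u) - \sum_k co1 k b * h2 k l u)
  (2%:R * (co0 b * h0 u) + \sum_k co1 k b * h1 k u).

Lemma co_corr u b : [/\ co0 (corr u b) = 0, forall k, co1 k (corr u b) = 0,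
  forall l, co2 l (corr u b) = - (co0 b * h1 l u) - \sum_k co1 k b * h2 k l u
  & co3 (corr u b) = 2%:R * (co0 b * h0 u) + \sum_k co1 k b * h1 k u].
Proof. by rewrite /corr -lock; exact: co_combE. Qed.

Lemma corr_linear u : linear (corr u).
Proof.
move=> c a b.
have [x0 x1 x2 x3] := co_corr u a; have [y0 y1 y2 y3] := co_corr u b.
have [z0 z1 z2 z3] := co_corr u (c *: a + b).
apply: co_ext => [|k|l|].
- by rewrite co0_scalar x0 y0 z0 mulr0 addr0.
- by rewrite co1_scalar x1 y1 z1 mulr0 addr0.
- rewrite co2_scalar x2 y2 z2 co0_scalar.
  under eq_bigr do rewrite co1_scalar mulrDl -mulrA.
  by rewrite big_split -mulr_sumr /=; ring.
- rewrite co3_scalar x3 y3 z3 co0_scalar.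
  under eq_bigr do rewrite co1_scalar mulrDl -mulrA.
  by rewrite big_split -mulr_sumr /=; ring.
Qed.

Lemma corr_eq u a b : co0 a = co0 b -> (forall k, co1 k a = co1 k b) ->
  corr u a = corr u b.
Proof.
move=> e0 e1; rewrite /corr e0; congr (locked co_comb _ _ _ _).
  by apply/funext => l; under eq_bigr do rewrite e1.
by under eq_bigr do rewrite e1.
Qed.

Lemma corr0 u : corr u 0 = 0.
Proof. by have := corr_linear u (-1) 0 0; rewrite scaler0 addr0 scaleN1r addNr. Qed.

Lemma corrB u a b : corr u (a - b) = corr u a - corr u b.
Proof. by have := corr_linear u (-1) b a; rewrite !scaleN1r ![- _ + _]addrC. Qed.

Lemma corr_corr u a : corr u (corr u a) = 0.
Proof.
have [e0 e1 _ _] := co_corr u a; rewrite -(corr0 u); apply: corr_eq => [|k].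
  by rewrite e0 (scalar_form0 co0_scalar).
by rewrite e1 (scalar_form0 (co1_scalar k)).
Qed.

(** [K = 1 + corr] intertwines the cup product with the quantum product:
    [d_j K + T_j * K - K (T_j cup) = 0]. *)
Definition fundK u b := b + corr u b.
Definition fundKi u b := b - corr u b.

Lemma fundK_K u : cancel (fundK u) (fundKi u).
Proof.
move=> b; rewrite /fundKi /fundK.
have -> : corr u (b + corr u b) = corr u b.
  by have := corr_linear u 1 b (corr u b); rewrite !scale1r corr_corr addr0.
by rewrite addrK.
Qed.

Lemma fundKi_K u : cancel (fundKi u) (fundK u).
Proof. by move=> b; rewrite /fundKi /fundK corrB corr_corr subr0 subrK. Qed.

Lemma fundK_linear u : linear (fundK u).
Proof. by move=> c a b; rewrite /fundK corr_linear scalerDr addrACA. Qed.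

Lemma fundKi_linear u : linear (fundKi u).
Proof. by move=> c a b; rewrite /fundKi corr_linear scalerBr opprD addrACA. Qed.

(** Compared with the cup product, the intersection numbers are corrected by
    the third derivatives of the holomorphic potential. *)
Lemma co_qprod u j b : upper_half u ->
  [/\ co0 (qprod T D u (tnth T j) b) = 0,
      forall k, co1 k (qprod T D u (tnth T j) b) = (j == k)%:R * co0 b,
      forall l, co2 l (qprod T D u (tnth T j) b) =
        \sum_k co1 k b * (kappa T j k l + h3 j k l u)
    & co3 (qprod T D u (tnth T j) b) = co2 j b].
Proof.
move=> hu; set b2 := hproj X (inord 1) b.
have i1 : nat_of_ord (@inord 3 1) = 1%N by exact: inordK.
have b2T : b2 \in hodge X 1 by have := hproj_mem (inord 1) b; rewrite i1.
have b2co k : co1 k b2 = co1 k b.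
  by rewrite -(coordT_co1 T_basis D_dual)// (coordT_hproj T_basis D_dual).
pose S := co_comb 0 (fun=> 0)
  (fun l => \sum_k co1 k b * (kappa T j k l + h3 j k l u)) 0.
have -> : qprod T D u (tnth T j) b = tnth T j * b - tnth T j * b2 + S.
  rewrite /qprod (@hproj_id _ _ (inord 1)) ?eqxx; last by rewrite i1 (T_hodge T_basis).
  rewrite -/b2; congr (_ + _).
  rewrite (bigD1 j)//= [X in _ + X]big1 ?addr0 => [|i ij].
    have cT k : coord T k (tnth T j) = (j == k)%:R.
      rewrite (coordT_co1 T_basis D_dual) ?(T_hodge T_basis)//.
      by have [_ ->] := co_T j.
    rewrite /S /co_comb !scale0r [\sum_(k < n) 0 *: _]big1; last by move=> *; rewrite scale0r.
    rewrite !add0r addr0; under [RHS]eq_bigr do rewrite scaler_suml.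
    rewrite exchange_big; apply: eq_bigr => k _; rewrite scaler_sumr; apply: eq_bigr => l _.
    rewrite cT eqxx mul1r /b2 (coordT_hproj T_basis D_dual) dPhi3E// scalerA.
    by [].
  rewrite big1// => k _; rewrite (coordT_co1 T_basis D_dual) ?(T_hodge T_basis)//.
  by have [_ -> _ _] := co_T j; rewrite eq_sym (negbTE ij) mul0r scale0r.
have [s0 s1 s2 s3] : [/\ co0 S = _, forall k, co1 k S = _, forall l, co2 l S = _ & co3 S = _]
  := co_combE _ _ _ _.
have [x0 x1 x2 x3] := co_cup j0 T_basis D_dual j b.
have [y0 y1 y2 y3] := co_cup j0 T_basis D_dual j b2.
have b20 : co0 b2 = 0.
  by rewrite -[LHS]/(integral_X X (b2 * pt)) (cup_gt3 b2T (pt_hodge j0 T_basis D_dual))// linear0.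
have b22 l : co2 l b2 = 0.
  exact: integral_hodge (cup_hodge b2T (T_hodge T_basis l) erefl).
split=> [|k|l|].
- by rewrite (scalar_formD co0_scalar) (scalar_formB co0_scalar) x0 y0 s0 subrr addr0.
- rewrite (scalar_formD (co1_scalar _)) (scalar_formB (co1_scalar _)) x1 y1 s1 b20.
  by rewrite mulr0 subr0 addr0.
- rewrite (scalar_formD (co2_scalar _)) (scalar_formB (co2_scalar _)) x2 y2 s2.
  by under [X in _ - X]eq_bigr do rewrite b2co; rewrite subrr add0r.
- by rewrite (scalar_formD co3_scalar) (scalar_formB co3_scalar) x3 y3 s3 b22 subr0 addr0.
Qed.

Lemma has_partials_co (f : 'rV[C]_n -> H) u (d : 'I_n -> H) :
  scalar_partials (fun x => co0 (f x)) u (fun j => co0 (d j)) ->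
  (forall k, scalar_partials (fun x => co1 k (f x)) u (fun j => co1 k (d j))) ->
  (forall l, scalar_partials (fun x => co2 l (f x)) u (fun j => co2 l (d j))) ->
  scalar_partials (fun x => co3 (f x)) u (fun j => co3 (d j)) ->
  has_partials f u d.
Proof.
move=> p0 p1 p2 p3 l hl.
have expand a : l a = l 1 * co0 a + \sum_k l (tnth T k) * co1 k a
    + \sum_k l (tnth D k) * co2 k a + l pt * co3 a.
  rewrite {1}(coE j0 T_basis D_dual a) !(scalar_formD hl) !(scalar_form_sum hl).
  rewrite !(scalar_formZ hl) [co0 a * _]mulrC [co3 a * _]mulrC.
  by congr (_ + _ + _ + _); apply: eq_bigr => k _; rewrite mulrC.
have -> : l \o f = fun x => l 1 * co0 (f x) + \sum_k l (tnth T k) * co1 k (f x)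
    + \sum_k l (tnth D k) * co2 k (f x) + l pt * co3 (f x).
  by apply/funext => x; exact: expand.
have q1 k := scalar_partialsZ (l (tnth T k)) (p1 k).
have q2 k := scalar_partialsZ (l (tnth D k)) (p2 k).
apply: scalar_partials_eq (scalar_partialsD (scalar_partialsD (scalar_partialsD
  (scalar_partialsZ _ p0) (scalar_partials_sum _ q1)) (scalar_partials_sum _ q2))
  (scalar_partialsZ _ p3)).
by move=> j /=; rewrite (expand (d j)).
Qed.

Lemma omega_hodge u : omega T u \in hodge X 1.
Proof. by apply: memv_suml => j _; rewrite memvZ// (T_hodge T_basis). Qed.

Lemma omega_partials u : has_partials (omega T) u (fun j => tnth T j).
Proof.
have := has_partials_comb (index_enum _) (fun k => tnth T k) (fun k => scalar_partials_coord k u).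
apply: has_partials_eq => j; rewrite (bigD1 j)//= eqxx scale1r big1 ?addr0// => k kj.
by rewrite eq_sym (negbTE kj) scale0r.
Qed.

Lemma texp_partials u b : has_partials (fun x => texp (omega T x) * b) u
  (fun j => - (tnth T j * (texp (omega T u) * b))).
Proof.
have w := omega_partials u.
have w2 := has_partialsM w w; have w3 := has_partialsM w w2.
have lZ (c : C) : linear ( *:%R c : H -> H) by move=> a x y; rewrite scalerDr !scalerA mulrC.
have lb : linear (fun x : H => x * b) by move=> a x y; rewrite mulrDl -scalerAl.
have lN : linear (fun x : H => - x) by move=> a x y; rewrite opprD scalerN.
have := has_partials_lin lb (has_partialsD (has_partialsD (has_partialsD
  (has_partials_cst (1 : H) u) (has_partials_lin lN w))
  (has_partials_lin (lZ (2%:R^-1)) w2)) (has_partials_lin lN (has_partials_lin (lZ (6%:R^-1)) w3))).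
apply: has_partials_eq => j; cbv beta.
have Tw3 : tnth T j * omega T u ^+ 3 = 0.
  exact: (cup_gt3 (T_hodge T_basis j) (hodge_exp 3 (omega_hodge u))).
set w' := omega T u in Tw3 *; set t := tnth T j in Tw3 *.
rewrite [in RHS]mulrA -[RHS]mulNr; congr (_ * b).
have wt : w' * t = t * w' := cup_comm _ _.
have E2 : t * w' + w' * t = 2%:R *: (t * w') by rewrite wt scaler_nat mulr2n.
have E3 : t * (w' * w') + w' * (t * w' + w' * t) = 3%:R *: (t * w' ^+ 2).
  by rewrite E2 -scalerAr [w' * (_ * _)]mulrA wt -mulrA -expr2 -{1}[t * _]scale1r -scalerDl.
have -> : t * texp w' = t - t * w' + (2%:R^-1 : C) *: (t * w' ^+ 2).
  by rewrite /texp mulrBr mulrDr mulrBr mulr1 -!scalerAr Tw3 scaler0 subr0.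
rewrite E3 E2 !scalerA mulVf ?pnatr_eq0// scale1r !opprD opprK add0r.
congr (_ + _ - _ *: _).
by field.
Qed.

(** The classical solution [exp (- omega) b], for the cup product, transported by
    [K]. *)
Definition flat_section b u : H := fundK u (texp (omega T u) * b).

(** In coordinates the equation reduces to [d_j h = h_j], [d_j h_k = h_jk],
    [d_j h_kl = h_jkl] and the symmetry of [h_kl]. *)
Lemma flat_section_partials b u : upper_half u ->
  has_partials (flat_section b) u (fun j => - qprod T D u (tnth T j) (flat_section b u)).
Proof.
move=> hu; pose y x := texp (omega T x) * b.
have yp := texp_partials u b.
have cc x := co_corr x (y x).
have F0 x : co0 (flat_section b x) = co0 (y x).
  by have [e _ _ _] := cc x; rewrite (scalar_formD co0_scalar) e addr0.
have F1 k x : co1 k (flat_section b x) = co1 k (y x).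
  by have [_ e _ _] := cc x; rewrite (scalar_formD (co1_scalar k)) e addr0.
have F2 l x : co2 l (flat_section b x) = co2 l (y x) + -1 * (co0 (y x) * h1 l x)
    + -1 * \sum_k co1 k (y x) * h2 k l x.
  have [_ _ e _] := cc x; rewrite (scalar_formD (co2_scalar l)) e !mulN1r addrA.
  by [].
have F3 x : co3 (flat_section b x) = co3 (y x) + 2%:R * (co0 (y x) * h0 x)
    + \sum_k co1 k (y x) * h1 k x.
  by have [_ _ _ e] := cc x; rewrite (scalar_formD co3_scalar) e addrA.
have Y0 := yp _ co0_scalar; have Y1 k := yp _ (co1_scalar k).
have Y2 l := yp _ (co2_scalar l); have Y3 := yp _ co3_scalar.
have cT j := co_cup j0 T_basis D_dual j (y u).
have cQ j := co_qprod j (flat_section b u) hu.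
apply: has_partials_co => [|k|l|].
- rewrite (_ : (fun x => _) = co0 \o y); last by apply/funext.
  apply: scalar_partials_eq Y0 => j /=; rewrite !(scalar_formN co0_scalar).
  by have [-> _ _ _] := cT j; have [-> _ _ _] := cQ j.
- rewrite (_ : (fun x => _) = co1 k \o y); last by apply/funext.
  apply: scalar_partials_eq (Y1 k) => j /=; rewrite !(scalar_formN (co1_scalar k)).
  by have [_ -> _ _] := cT j; have [_ -> _ _] := cQ j; rewrite F0.
- rewrite (_ : (fun x => _) = fun x => (co2 l \o y) x + -1 * ((co0 \o y) x * h1 l x)
    + -1 * \sum_k (co1 k \o y) x * h2 k l x); last by apply/funext => x; rewrite F2.
  have q k := scalar_partialsM (Y1 k) (h2_partials k l hu).
  apply: scalar_partials_eq (scalar_partialsD (scalar_partialsD (Y2 l)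
    (scalar_partialsZ (-1) (scalar_partialsM Y0 (h1_partials l hu))))
    (scalar_partialsZ (-1) (scalar_partials_sum _ q))) => j /=.
  rewrite !(scalar_formN (co2_scalar l)) !(scalar_formN co0_scalar).
  have [-> _ -> _] := cT j; have [_ _ -> _] := cQ j.
  under [X in _ + -1 * X]eq_bigr do rewrite (scalar_formN (co1_scalar _)).
  have -> : \sum_k (- co1 k (tnth T j * y u) * h2 k l u + co1 k (y u) * h3 j k l u)
     = - (co0 (y u) * h2 j l u) + \sum_k co1 k (y u) * h3 j k l u.
    rewrite big_split /=; congr (_ + _); rewrite (bigD1 j)//= big1 ?addr0 => [|k kj].
      by have [_ -> _ _] := cT j; rewrite eqxx mul1r mulNr.
    by have [_ -> _ _] := cT j; rewrite eq_sym (negbTE kj) mul0r oppr0 mul0r.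
  have -> : \sum_k co1 k (flat_section b u) * (kappa T j k l + h3 j k l u) =
     \sum_k co1 k (y u) * kappa T j k l + \sum_k co1 k (y u) * h3 j k l u.
    by rewrite -big_split; apply: eq_bigr => k _; rewrite F1 mulrDr.
  by ring.
- rewrite (_ : (fun x => _) = fun x => (co3 \o y) x + 2%:R * ((co0 \o y) x * h0 x)
    + \sum_k (co1 k \o y) x * h1 k x); last by apply/funext => x; rewrite F3.
  have q k := scalar_partialsM (Y1 k) (h1_partials k hu).
  apply: scalar_partials_eq (scalar_partialsD (scalar_partialsD Y3
    (scalar_partialsZ 2%:R (scalar_partialsM Y0 (h0_partials hu))))
    (scalar_partials_sum _ q)) => j /=.
  rewrite !(scalar_formN co3_scalar) !(scalar_formN co0_scalar).
  have [-> _ _ ->] := cT j; have [_ _ _ ->] := cQ j.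
  under [X in _ + X = _]eq_bigr do rewrite (scalar_formN (co1_scalar _)).
  have -> : \sum_k (- co1 k (tnth T j * y u) * h1 k u + co1 k (y u) * h2 j k u)
     = - (co0 (y u) * h1 j u) + \sum_k co1 k (y u) * h2 k j u.
    rewrite big_split /=; congr (_ + _); last by apply: eq_bigr => k _; rewrite h2_sym.
    rewrite (bigD1 j)//= big1 ?addr0 => [|k kj].
      by have [_ -> _ _] := cT j; rewrite eqxx mul1r mulNr.
    by have [_ -> _ _] := cT j; rewrite eq_sym (negbTE kj) mul0r oppr0 mul0r.
  by rewrite F2; ring.
Qed.

Lemma flat_section_flat b : dubrovin_flat T D (flat_section b).
Proof.
split=> [u hu|u j hu]; have [d p] := diff_of_has_partials (flat_section_partials b hu) => //.
by rewrite p addNr.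
Qed.

(** ** The monodromy logarithms *)

Definition lfun_of (V W : vectType C) (f : V -> W) (hf : linear f) : 'Hom(V, W) :=
  linfun (HB.pack f (GRing.isLinear.Build C V W _ f hf) : {linear V -> W}).

Lemma lfun_ofE (V W : vectType C) (f : V -> W) (hf : linear f) v :
  lfun_of hf v = f v.
Proof. by rewrite lfunE. Qed.

Lemma mulT_linear j : linear (fun b : H => tnth T j * b).
Proof. by move=> c a b; rewrite mulrDr -scalerAr. Qed.

Lemma conj_mulT_linear j u : linear (fun b => fundK u (tnth T j * fundKi u b)).
Proof. by move=> c a b; rewrite fundKi_linear mulT_linear fundK_linear. Qed.

Definition Nconj j u : 'End(H) := lfun_of (conj_mulT_linear j u).

Lemma fundKN u a : fundK u (- a) = - fundK u a.
Proof. by rewrite -scaleN1r -[-1 *: a]addr0 fundK_linear scaleN1r /fundK corr0 !addr0. Qed.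

Lemma iter_Nconj j u (m : nat) b :
  iter m (- Nconj j u : 'End(H)) b = fundK u ((- tnth T j) ^+ m * fundKi u b).
Proof.
elim: m => [|m IH]; first by rewrite expr0 mul1r /= fundKi_K.
rewrite iterS IH opp_lfunE lfun_ofE fundK_K exprS -mulrA mulNr.
by rewrite fundKN.
Qed.

Lemma T_exp4 j : (- tnth T j) ^+ 4 = 0.
Proof.
rewrite exprS; apply: (cup_gt3 (_ : - tnth T j \in hodge X 1)
  (hodge_exp 3 (_ : - tnth T j \in hodge X 1))) => //; by rewrite memvN (T_hodge T_basis).
Qed.

Lemma nilpotent_Nconj j u b : iter 4 (- Nconj j u : 'End(H)) b = 0.
Proof. by rewrite iter_Nconj T_exp4 mul0r /fundK corr0 addr0. Qed.

Lemma nexp_Nconj j u b :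
  nexp (- Nconj j u : 'End(H)) b = fundK u (texp (tnth T j) * fundKi u b).
Proof.
rewrite (nexp_trunc _ (nilpotent_Nconj j u)).
have fK_sum (m : nat) (F : nat -> H) (c : nat -> C) :
    \sum_(k < m) c k *: fundK u (F k) = fundK u (\sum_(k < m) c k *: F k).
  elim: m => [|m IH]; first by rewrite !big_ord0 /fundK corr0 addr0.
  by rewrite !big_ord_recr /= IH addrC [in RHS]addrC fundK_linear.
under eq_bigr do rewrite iter_Nconj.
rewrite (fK_sum 4%N (fun k : nat => (- tnth T j) ^+ k * fundKi u b)
  (fun k : nat => (k`!%:R : C)^-1)); congr fundK.
under eq_bigr do rewrite scalerAl.
rewrite -mulr_suml; congr (_ * _); rewrite !big_ord_recr big_ord0 /= add0r.
rewrite invr1 !scale1r expr0 expr1 sqrrN /texp; congr (_ - _ + _ + _).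
by rewrite exprNn -signr_odd /= expr1 mulN1r scalerN.
Qed.

Lemma omega_delta u j : omega T (u + delta_mx 0 j) = omega T u + tnth T j.
Proof.
rewrite /omega; under eq_bigr do rewrite mxE scalerDl.
rewrite big_split /=; congr (_ + _); rewrite (bigD1 j)//= mxE !eqxx scale1r.
by rewrite big1 ?addr0// => i /negbTE ij; rewrite mxE ij andbF scale0r.
Qed.

Lemma corr_periodic u j b : corr (u + delta_mx 0 j) b = corr u b.
Proof.
rewrite /corr h0_periodic; congr (locked co_comb _ _ _ (_ + _)).
  apply/funext => l; rewrite h1_periodic; congr (_ - _).
  by apply: eq_bigr => k _; rewrite h2_periodic.
by apply: eq_bigr => k _; rewrite h1_periodic.
Qed.

Section MonodromyLog.
Variable N : 'I_n -> 'rV[C]_n -> 'End(H).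
Hypothesis N_log : is_monodromy_log T D N.

(** Every vector is the value at [u] of a flat section, so the monodromy
    determines [exp (- N_j)], hence [N_j]. *)
Lemma monodromy_log_eq j u : upper_half u -> N j (qmap u) = Nconj j u.
Proof.
move=> hu; have [_ /(_ u hu)[nilN monN]] := N_log j.
suff /oppr_inj : - N j (qmap u) = - Nconj j u by [].
apply: nexp_inj => [| |v].
- have [m hm] := nilN; exists m => v.
  have -> : iter m (- N j (qmap u) : 'End(H)) v = (-1) ^+ m *: iter m (N j (qmap u)) v.
    elim: m {hm} => [|m IH]; first by rewrite scale1r.
    by rewrite !iterS IH opp_lfunE linearZ exprS mulN1r scaleNr.
  by rewrite hm scaler0.
- by exists 4%N => v; exact: nilpotent_Nconj.
pose b := texp (- omega T u) * fundKi u v.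
have sb : flat_section b u = v.
  by rewrite /flat_section /b mulrA (texpNK (omega_hodge u)) mul1r fundKi_K.
rewrite -[in LHS]sb -(monN _ (flat_section_flat b)) nexp_Nconj /flat_section omega_delta.
rewrite texpD ?omega_hodge ?(T_hodge T_basis)// /fundK corr_periodic -/(fundK u _).
congr fundK; rewrite /b -mulrA [texp (tnth T j) * _]mulrA.
have -> : texp (tnth T j) * texp (- omega T u) = texp (- omega T u) * texp (tnth T j) :=
  cup_comm _ _.
by rewrite -mulrA mulrA (texpNK (omega_hodge u)) mul1r.
Qed.

Let u1 : 'rV[C]_n := vertical 1.

Let u1_upper : upper_half u1. Proof. by move=> j; rewrite mxE. Qed.

Lemma upper_vertical u (m : nat) : upper_half u -> upper_half (u + vertical m%:R).
Proof. by move=> hu; apply: upper_half_up. Qed.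

Lemma corr_vanishes u (b : nat -> H) (b0 : H) (l : H -> C) : upper_half u ->
  (forall phi : H -> C, scalar phi -> (fun m => phi (b m)) @ \oo --> phi b0) -> scalar l ->
  (fun m => l (corr (u + vertical m%:R) (b m))) @ \oo --> (0 : C).
Proof.
move=> hu hb hl.
have b_0 := hb _ co0_scalar; have b_1 k := hb _ (co1_scalar k).
have v0 := h0_vanishes hu; have v1 k := h1_vanishes k hu; have v2 k i := h2_vanishes k i hu.
have zM (f g : nat -> C) (c : C) : f @ \oo --> c -> g @ \oo --> (0 : C) ->
    (fun m => f m * g m) @ \oo --> (0 : C).
  by move=> hf hg; have := cvg_muln hf hg; rewrite mulr0.
have zS (J : Type) (r : seq J) (f : J -> nat -> C) : (forall i, f i @ \oo --> (0 : C)) ->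
    (fun m => \sum_(i <- r) f i m) @ \oo --> (0 : C).
  by move=> h; have := cvg_sum_nat (r := r) h; rewrite big1.
have zD (f g : nat -> C) : f @ \oo --> (0 : C) -> g @ \oo --> (0 : C) ->
    (fun m => f m + g m) @ \oo --> (0 : C).
  by move=> hf hg; have := cvg_addn hf hg; rewrite addr0.
have zZ (c : C) (f : nat -> C) : f @ \oo --> (0 : C) -> (fun m => c * f m) @ \oo --> (0 : C).
  by apply: zM; exact: cvg_cst.
have expand m : l (corr (u + vertical m%:R) (b m)) =
   \sum_i l (tnth D i) * (-1 * (co0 (b m) * h1 i (u + vertical m%:R))
      + -1 * \sum_k co1 k (b m) * h2 k i (u + vertical m%:R))
   + l pt * (2%:R * (co0 (b m) * h0 (u + vertical m%:R))
      + \sum_k co1 k (b m) * h1 k (u + vertical m%:R)).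
  have [e0 e1 e2 e3] := co_corr (u + vertical m%:R) (b m).
  rewrite {1}(coE j0 T_basis D_dual (corr _ _)) e0 e3 scale0r add0r.
  rewrite [\sum_(k < n) _ *: tnth T k]big1 => [|k _]; last by rewrite e1 scale0r.
  rewrite add0r (scalar_formD hl) (scalar_form_sum hl) (scalar_formZ hl).
  congr (_ + _); last by rewrite mulrC.
  by apply: eq_bigr => i _; rewrite e2 mulrC !mulN1r.
rewrite (funext expand).
apply: (@zD).
  apply: (@zS) => i; apply: (@zZ); apply: (@zD); apply: (@zZ); first exact: zM b_0 (v1 i).
  by apply: (@zS) => k; exact: zM (b_1 k) (v2 k i).
apply: (@zZ); apply: (@zD); first by apply: (@zZ); exact: zM b_0 v0.
by apply: (@zS) => k; exact: zM (b_1 k) (v1 k).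
Qed.

Lemma scalar_separates (x y : H) :
  (forall phi : H -> C, scalar phi -> phi x = phi y) -> x = y.
Proof.
move=> h; apply: co_ext => [|k|i|]; apply: h.
- exact: co0_scalar.
- exact: co1_scalar.
- exact: co2_scalar.
- exact: co3_scalar.
Qed.

Lemma polydisc0 : @polydisc R n 0.
Proof. by move=> j; rewrite mxE normr0 ltr01. Qed.

Lemma holomorphic_cvg0 (V : vectType C) (f : 'rV[C]_n -> V) (l : V -> C) u :
  holomorphic_on (@polydisc R n) f -> scalar l ->
  (fun m : nat => l (f (qmap (u + vertical m%:R)))) @ \oo --> l (f 0).
Proof.
move=> hf hl; have [df _] := has_partials_of_diff (hf 0 polydisc0) hl.
have cf : {for 0, continuous (l \o f)} by exact: differentiable_continuous.
exact: (cvg_comp _ _ (qmap_vertical_cvg u) cf).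
Qed.

(** [K] tends to the identity at the large radius limit, and [N_j] is
    continuous there. *)
Lemma monodromy_log0 j b : N j 0 b = tnth T j * b.
Proof.
apply: scalar_separates => l hl; have [holN _] := N_log j.
have hl' : scalar (fun f : 'End(H) => l (f b)).
  by move=> c f g; rewrite add_lfunE scale_lfunE hl.
have lim1 := holomorphic_cvg0 u1 holN hl'.
have lT : scalar (fun x => l (tnth T j * x)) by move=> c x y; rewrite mulT_linear hl.
have cb : forall l' : H -> C, scalar l' -> (fun m : nat => l' b) @ \oo --> l' b.
  by move=> l' _; exact: cvg_cst.
have cTb : forall l' : H -> C, scalar l' ->
    (fun m : nat => l' (tnth T j * b)) @ \oo --> l' (tnth T j * b).
  by move=> l' _; exact: cvg_cst.
have lim2 : (fun m : nat => l (N j (qmap (u1 + vertical m%:R)) b)) @ \oo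
    --> l (tnth T j * b) - 0 + 0.
  rewrite (_ : (fun m => _) = fun m => l (tnth T j * b)
     - l (tnth T j * corr (u1 + vertical m%:R) b)
     + l (corr (u1 + vertical m%:R) (tnth T j * b))).
    apply: cvg_addn; last exact: (corr_vanishes u1_upper cTb hl).
    by apply: cvg_subn; [exact: cvg_cst|exact: (corr_vanishes u1_upper cb lT)].
  apply/funext => m; rewrite monodromy_log_eq; last exact: upper_vertical.
  set v := u1 + _; rewrite lfun_ofE /fundK /fundKi (scalar_formD hl) mulrBr.
  rewrite (scalar_formB hl); congr (_ + l _).
  have [x0 x1 _ _] := co_corr v b.
  have [c0 c1 _ _] := co_cup j0 T_basis D_dual j (corr v b).
  apply: corr_eq => [|k].
    by rewrite (scalar_formB co0_scalar) c0 subr0.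
  by rewrite (scalar_formB (co1_scalar k)) c1 x0 mulr0 subr0.
have := cvg_unique (@norm_hausdorff _ _) lim1 lim2; rewrite subr0 addr0; exact.
Qed.

(** ** Canonical flat sections *)

(** [K^-1 s] has vanishing partial derivatives, and tends to [s 0] at the large
    radius limit. *)
Lemma canonical_flat_fundK s u : canonical_flat T D N s -> upper_half u ->
  s (qmap u) = fundK u (s 0).
Proof.
move=> [hs fs] hu; pose g v := fundKi v (s (qmap v)).
have sp v : upper_half v -> has_partials (s \o @qmap R n) v
    (fun j => N j (qmap v) (s (qmap v)) - qprod T D v (tnth T j) (s (qmap v))).
  move=> hv.
  have dsq : differentiable (fun x => passmx.rVof (vbasis {:H}) ((s \o @qmap R n) x)) v.
    apply: (@differentiable_comp _ _ _ _ (@qmap R n)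
      (fun q => passmx.rVof (vbasis {:H}) (s q))); first exact: qmap_diff.
    exact/hs/qmap_polydisc.
  apply: has_partials_eq (has_partials_of_diff dsq) => j.
  apply/eqP; rewrite -subr_eq0 opprB addrA; apply/eqP; exact: fs.
have gp v : upper_half v -> has_partials g v (fun=> 0).
  move=> hv; set S := s (qmap v).
  have cc x := co_corr x (s (qmap x)).
  have F0 x : co0 (g x) = co0 (s (qmap x)).
    by have [e _ _ _] := cc x; rewrite (scalar_formB co0_scalar) e subr0.
  have F1 k x : co1 k (g x) = co1 k (s (qmap x)).
    by have [_ e _ _] := cc x; rewrite (scalar_formB (co1_scalar k)) e subr0.
  have F2 l x : co2 l (g x) = co2 l (s (qmap x)) + co0 (s (qmap x)) * h1 l x
      + \sum_k co1 k (s (qmap x)) * h2 k l x.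
    have [_ _ e _] := cc x; rewrite (scalar_formB (co2_scalar l)) e; ring.
  have F3 x : co3 (g x) = co3 (s (qmap x)) + -2%:R * (co0 (s (qmap x)) * h0 x)
      + -1 * \sum_k co1 k (s (qmap x)) * h1 k x.
    by have [_ _ _ e] := cc x; rewrite (scalar_formB co3_scalar) e; ring.
  pose y := s \o @qmap R n.
  have Y0 := sp v hv _ co0_scalar; have Y1 k := sp v hv _ (co1_scalar k).
  have Y2 l := sp v hv _ (co2_scalar l); have Y3 := sp v hv _ co3_scalar.
  have cN j : [/\ co0 (N j (qmap v) S) = 0,
      forall k, co1 k (N j (qmap v) S) = (j == k)%:R * co0 S,
      forall l, co2 l (N j (qmap v) S) = \sum_k co1 k S * kappa T j k l
         - co0 S * h2 j l v
    & co3 (N j (qmap v) S) = co2 j (g v) + co0 S * h1 j v].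
    rewrite monodromy_log_eq// lfun_ofE -/(g v).
    have [t0 t1 t2 t3] := co_cup j0 T_basis D_dual j (g v).
    have [x0 x1 x2 x3] := co_corr v (tnth T j * g v).
    have sd (F : 'I_n -> C) : \sum_k (j == k)%:R * co0 (g v) * F k = co0 S * F j.
      rewrite (bigD1 j)//= eqxx mul1r F0 big1 ?addr0// => k kj.
      by rewrite eq_sym (negbTE kj) !mul0r.
    split=> [|k|l|]; rewrite /fundK.
    - by rewrite (scalar_formD co0_scalar) x0 t0 addr0.
    - by rewrite (scalar_formD (co1_scalar k)) x1 t1 addr0 F0.
    - rewrite (scalar_formD (co2_scalar l)) x2 t2 t0 mul0r oppr0 sub0r.
      under [in X in _ - X]eq_bigr do rewrite t1.
      by rewrite sd; congr (_ - _); apply: eq_bigr => k _; rewrite F1.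
    - rewrite (scalar_formD co3_scalar) x3 t3 t0 mul0r mulr0 add0r.
      by under [in X in _ + X]eq_bigr do rewrite t1; rewrite sd.
  have cQ j := co_qprod j S hv.
  have d0 j : co0 (N j (qmap v) S - qprod T D v (tnth T j) S) = 0.
    have [n0 _ _ _] := cN j; have [q0 _ _ _] := cQ j.
    by rewrite (scalar_formB co0_scalar) n0 q0 subrr.
  have d1 j k : co1 k (N j (qmap v) S - qprod T D v (tnth T j) S) = 0.
    have [_ n1 _ _] := cN j; have [_ q1 _ _] := cQ j.
    by rewrite (scalar_formB (co1_scalar k)) n1 q1 subrr.
  have d2 j l : co2 l (N j (qmap v) S - qprod T D v (tnth T j) S) =
      - (co0 S * h2 j l v) - \sum_k co1 k S * h3 j k l v.
    have [_ _ n2 _] := cN j; have [_ _ q2 _] := cQ j.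
    rewrite (scalar_formB (co2_scalar l)) n2 q2.
    have -> : \sum_k co1 k S * (kappa T j k l + h3 j k l v) =
        \sum_k co1 k S * kappa T j k l + \sum_k co1 k S * h3 j k l v.
      by rewrite -big_split; apply: eq_bigr => k _; rewrite mulrDr.
    by ring.
  have d3 j : co3 (N j (qmap v) S - qprod T D v (tnth T j) S) =
      2%:R * (co0 S * h1 j v) + \sum_k co1 k S * h2 k j v.
    have [_ _ _ n3] := cN j; have [_ _ _ q3] := cQ j.
    by rewrite (scalar_formB co3_scalar) n3 q3 F2; ring.
  apply: has_partials_co => [|k|l|].
  - rewrite (_ : (fun x => _) = co0 \o y); last by apply/funext.
    apply: scalar_partials_eq Y0 => j /=.
    by rewrite d0 (scalar_form0 co0_scalar).
  - rewrite (_ : (fun x => _) = co1 k \o y); last by apply/funext.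
    apply: scalar_partials_eq (Y1 k) => j /=.
    by rewrite d1 (scalar_form0 (co1_scalar k)).
  - rewrite (_ : (fun x => _) = fun x => (co2 l \o y) x + (co0 \o y) x * h1 l x
      + \sum_k (co1 k \o y) x * h2 k l x); last by apply/funext => x; rewrite F2.
    have q k := scalar_partialsM (Y1 k) (h2_partials k l hv).
    apply: scalar_partials_eq (scalar_partialsD (scalar_partialsD (Y2 l)
      (scalar_partialsM Y0 (h1_partials l hv))) (scalar_partials_sum _ q)) => j /=.
    rewrite -/S d2 d0 (scalar_form0 (co2_scalar l)) mul0r add0r.
    under [X in _ + X = _]eq_bigr do rewrite d1 mul0r add0r.
    by rewrite /y /= -/S; ring.
  - rewrite (_ : (fun x => _) = fun x => (co3 \o y) x + -2%:R * ((co0 \o y) x * h0 x)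
      + -1 * \sum_k (co1 k \o y) x * h1 k x); last by apply/funext => x; rewrite F3.
    have q k := scalar_partialsM (Y1 k) (h1_partials k hv).
    apply: scalar_partials_eq (scalar_partialsD (scalar_partialsD Y3
      (scalar_partialsZ (-2%:R) (scalar_partialsM Y0 (h0_partials hv))))
      (scalar_partialsZ (-1) (scalar_partials_sum _ q))) => j /=.
    rewrite -/S d3 d0 (scalar_form0 co3_scalar) mul0r add0r.
    under [X in _ + -1 * X]eq_bigr do rewrite d1 mul0r add0r h2_sym.
    by rewrite /y /= -/S; ring.
suff gE : g u = s 0 by rewrite -gE /g fundKi_K.
apply: scalar_separates => l hl.
have const m : l (g (u + vertical m%:R)) = l (g u).
  apply: (@zero_partials_vertical _ _ (l \o g)) => // v hv.
  by apply: scalar_partials_eq (gp v hv l hl) => j /=; rewrite (scalar_form0 hl).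
have scvg (l' : H -> C) : scalar l' ->
    (fun m : nat => l' (s (qmap (u + vertical m%:R)))) @ \oo --> l' (s 0).
  by move=> hl'; exact: (holomorphic_cvg0 u hs hl').
have lim : (fun m : nat => l (g (u + vertical m%:R))) @ \oo --> l (s 0) - 0.
  rewrite (_ : (fun m => _) = fun m => l (s (qmap (u + vertical m%:R)))
     - l (corr (u + vertical m%:R) (s (qmap (u + vertical m%:R))))).
    apply: cvg_subn; first exact: scvg.
    exact: (corr_vanishes hu scvg hl).
  by apply/funext => m; rewrite /g /fundKi (scalar_formB hl).
have lim' : (fun m : nat => l (g (u + vertical m%:R))) @ \oo --> l (g u).
  rewrite (_ : (fun m => _) = cst (l (g u))); first exact: cvg_cst.
  by apply/funext => m; rewrite const.
have := cvg_unique (@norm_hausdorff _ _) lim' lim; rewrite subr0; exact.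
Qed.


(** ** The period map and the Higgs field *)

Section Gamma.
Variables (U : set 'rV[C]_n) (G : 'rV[C]_n -> 'End(H)).
Hypothesis U_open : open U.
Hypothesis G_Gamma : is_Gamma T D N U G.

(** An element [exp (Gamma) v] of [psi] is the value at [0] of a canonical flat
    section [s] whose value at [q] lies in the Hodge filtration, and
    [s q = K (s 0)]. *)
Lemma fundK_nexp_filtration u p v : upper_half u -> U (qmap u) -> (p <= 3)%N ->
  v \in hodge_filtration X p ->
  fundK u (nexp (G (qmap u)) v) \in hodge_filtration X p.
Proof.
move=> hu hU p3 hv; have [_ _ /(_ _ hU)[_ _ /(_ p p3) psiE]] := G_Gamma.
have : psi T D N p (qmap u) (nexp (G (qmap u)) v) by rewrite psiE; exists v.
by move=> [s [cs sF s0]]; rewrite -s0 -(canonical_flat_fundK cs hu).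
Qed.

Lemma high2_corr u b : high 2 (corr u b).
Proof.
move=> c c2; have [e0 e1 _ _] := co_corr u b.
rewrite (coE j0 T_basis D_dual (corr u b)) e0 scale0r add0r.
rewrite [\sum_(k < n) _ *: tnth T k]big1 => [|k _]; last by rewrite e1 scale0r.
rewrite add0r linearD linear_sum linearZ /= big1 => [|k _].
  rewrite (@hproj_id _ _ (inord 3)) ?inordK ?(pt_hodge j0 T_basis D_dual)//.
  rewrite ifF ?scaler0 ?addr0//; apply/negbTE.
  by apply: contraTneq c2 => ->; rewrite inordK.
rewrite linearZ /= (@hproj_id _ _ (inord 2)) ?inordK ?(D_hodge D_dual)//.
rewrite ifF ?scaler0//; apply/negbTE.
by apply: contraTneq c2 => ->; rewrite inordK.
Qed.

Lemma corr_high2 u b : high 2 b -> corr u b = 0.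
Proof.
move=> hb; rewrite -(corr0 u); apply: corr_eq => [|k].
  rewrite (scalar_form0 co0_scalar).
  rewrite -[LHS](@integral_hproj _ _ (inord 0) (inord 3)) ?inordK ?(pt_hodge j0 T_basis D_dual)//.
  by rewrite hb ?mul0r ?linear0// inordK.
rewrite (scalar_form0 (co1_scalar k)).
rewrite -[LHS](@integral_hproj _ _ (inord 1) (inord 2)) ?inordK ?(D_hodge D_dual)//.
by rewrite hb ?mul0r ?linear0// inordK.
Qed.

Lemma high_corr u m b : high m b -> high m.+1 (corr u b).
Proof.
move=> hb; have [m2|m2] := leqP m.+1 2; first exact: (highW (high2_corr u b) m2).
by rewrite corr_high2; [move=> c _; rewrite linear0|exact: (highW hb (m2 : (2 <= m)%N))].
Qed.

(** [K exp (Gamma)] preserves the Hodge filtration and is unipotent for the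
    grading, hence is the identity. *)
Lemma nexp_Gamma u (p : 'I_4) v : upper_half u -> U (qmap u) -> v \in hodge X p ->
  nexp (G (qmap u)) v = fundKi u v.
Proof.
move=> hu hU hv; have [_ _ /(_ _ hU)[raise _ _]] := G_Gamma.
have Fv := mem_filtration hv; have hiv := high_hodge hv.
suff e : fundK u (nexp (G (qmap u)) v) = v by rewrite -[in RHS]e fundK_K.
apply/subr0_eq/(@filtration_high_eq0 _ _ p).
  by rewrite memvB// fundK_nexp_filtration// leq_subr.
have hn := high_nexp1 raise hiv.
have hn0 : high p (nexp (G (qmap u)) v).
  rewrite -[nexp _ _](subrK v); apply: highD hiv; exact: (highW hn (leqnSn _)).
by rewrite /fundK addrAC; apply: highD hn (high_corr _ hn0).
Qed.

Lemma hproj_Gamma u (p q : 'I_4) v : upper_half u -> U (qmap u) -> v \in hodge X p ->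
  q = p.+1 :> nat ->
  hproj X q (G (qmap u) v) = - hproj X q (corr u v).
Proof.
move=> hu hU hv qp; have [_ _ /(_ _ hU)[raise _ _]] := G_Gamma.
have := high_nexp2 raise (high_hodge hv).
rewrite (nexp_Gamma hu hU hv) => /(_ q); rewrite qp ltnSn => /(_ isT).
rewrite /fundKi [v - _]addrC addrK linearB /= linearN /= => /eqP.
by rewrite subr_eq0 => /eqP.
Qed.

Lemma rank1_linear k l : linear (fun b => co1 k b *: tnth D l).
Proof. by move=> c a b; rewrite co1_scalar scalerDl scalerA. Qed.

Definition rank1 k l : 'End(H) := lfun_of (rank1_linear k l).

(** [exp (Gamma) = 1 - corr], and the degree one part of [- corr] sends [T_k] to
    [sum_l h_kl T_l^vee]. *)
Lemma Gamma1E u : upper_half u -> U (qmap u) ->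
  degree_comp 1 (G (qmap u)) =
  \sum_(p : 'I_n * 'I_n) h2 p.1 p.2 u *: rank1 p.1 p.2.
Proof.
move=> hu hU; apply/lfunP => b.
have i1 : nat_of_ord (@inord 3 1) = 1%N by exact: inordK.
have i2 : nat_of_ord (@inord 3 2) = 2%N by exact: inordK.
rewrite degree_compE (bigD1 (inord 1))//= [X in _ + X]big1 ?addr0 => [|p p1].
  rewrite (bigD1 (inord 2)) ?i1 ?i2//= [X in _ + X]big1 ?addr0 => [|q]; last first.
    by rewrite -val_eqE /= i2 => /andP[/eqP ->].
  have hb := hproj_mem (inord 1) b.
  rewrite (hproj_Gamma hu hU hb) ?i1 ?i2// (hproj2E T_basis D_dual).
  have [_ _ e2 _] := co_corr u (hproj X (inord 1) b).
  rewrite -(pair_bigA _ (fun k l => h2 k l u *: rank1 k l)) exchange_big /=.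
  rewrite sum_lfunE -sumrN; apply: eq_bigr => l _.
  rewrite sum_lfunE e2 -scaleNr opprD !opprK.
  have -> : co0 (hproj X (inord 1) b) = 0.
    rewrite -[LHS]/(integral_X X (hproj X (inord 1) b * pt)).
    by rewrite (cup_gt3 hb (pt_hodge j0 T_basis D_dual)) ?i1// linear0.
  rewrite mul0r add0r scaler_suml; apply: eq_bigr => k _.
  rewrite scale_lfunE lfun_ofE scalerA mulrC; congr (_ * _ *: _).
  by apply: (@integral_hproj _ _ _ (inord 2)); rewrite ?i1 ?i2//; exact: (D_hodge D_dual).
rewrite big1// => q /eqP qp.
rewrite (hproj_Gamma hu hU (hproj_mem p b)) ?qp ?addn1//.
have [p2|p2] := leqP 2 p.
  have -> : corr u (hproj X p b) = 0.
    by apply: corr_high2; exact: (highW (high_hodge (hproj_mem p b)) p2).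
  by rewrite linear0 oppr0.
have p0 : p = 0%N :> nat.
  by move: p1 p2; rewrite -val_eqE /= i1; case: (nat_of_ord p) => [|[]].
by rewrite high2_corr ?oppr0// qp p0.
Qed.

(** Both sides have the coordinates of the small quantum product: the cup
    product comes from [N_j], the third derivatives of the potential from
    differentiating [Gamma_{-1}], whose entries are second derivatives. *)
Lemma higgs_fieldE u j b : upper_half u -> U (qmap u) ->
  higgs_field N G u (delta_mx 0 j) b = qprod T D u (tnth T j) b.
Proof.
move=> hu hU.
have -> : higgs_field N G u (delta_mx 0 j) =
    N j 0 + partial (fun v => degree_comp 1 (G (qmap v))) j u.
  rewrite /higgs_field (bigD1 j)//= mxE !eqxx scale1r big1 ?addr0// => i /negbTE ij.
  by rewrite mxE ij andbF scale0r.
have gp : has_partials (fun v => degree_comp 1 (G (qmap v))) u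
    (fun i => \sum_(p : 'I_n * 'I_n) h3 i p.1 p.2 u *: rank1 p.1 p.2).
  apply: has_partials_near (has_partials_comb _ (fun p => rank1 p.1 p.2)
    (fun p : 'I_n * 'I_n => h2_partials p.1 p.2 hu)).
  near=> v; apply/esym/Gamma1E.
    by near: v; exact: (open_nbhs_nbhs (conj open_upper_half hu)).
  near: v; have nU : nbhs (qmap u) U := open_nbhs_nbhs (conj U_open hU).
  exact: (qmap_continuous nU).
have [_ ->] := diff_of_has_partials gp.
rewrite add_lfunE monodromy_log0.
have -> : (\sum_(p : 'I_n * 'I_n) h3 j p.1 p.2 u *: rank1 p.1 p.2) b =
    co_comb 0 (fun=> 0) (fun l => \sum_k co1 k b * h3 j k l u) 0.
  rewrite /co_comb !scale0r [\sum_(k < n) 0 *: _]big1; last by move=> *; rewrite scale0r.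
  rewrite !add0r addr0 sum_lfunE -(pair_bigA _ (fun k l => (h3 j k l u *: rank1 k l) b)) /=.
  rewrite exchange_big; apply: eq_bigr => l _; rewrite scaler_suml; apply: eq_bigr => k _.
  by rewrite scale_lfunE lfun_ofE scalerA mulrC.
have [c0 c1 c2 c3] := co_cup j0 T_basis D_dual j b.
have [q0 q1 q2 q3] := co_qprod j b hu.
set S := co_comb _ _ _ _.
have [s0 s1 s2 s3] : [/\ co0 S = _, forall k, co1 k S = _, forall l, co2 l S = _ & co3 S = _]
  := co_combE _ _ _ _.
apply: co_ext => [|k|l|].
- by rewrite (scalar_formD co0_scalar) c0 s0 q0 addr0.
- by rewrite (scalar_formD (co1_scalar k)) c1 s1 q1 addr0.
- rewrite (scalar_formD (co2_scalar l)) c2 s2 q2 -big_split.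
  by apply: eq_bigr => k _; rewrite mulrDr.
- by rewrite (scalar_formD co3_scalar) c3 s3 q3 addr0.
Unshelve. all: by end_near. Qed.

End Gamma.
End MonodromyLog.
End Variation.

(** * The Gromov-Witten potential *)

Section Potential.
Context {R : realType} {X : cy3 R} {n : nat} (T : n.-tuple X).
Local Notation C := (cplx R).
Hypothesis T_lrl : large_radius_limit T.
Hypothesis gw_conv : gw_convergent T.
Implicit Types (u : 'rV[C]_n) (b : curves X) (j k l : 'I_n).

Let T_basis : basis_of (hodge X 1) T.
Proof. by case: T_lrl => -[]. Qed.

Lemma period_int_T b k : is_intC (period b (tnth T k)).
Proof.
have [[_ TZ] _ _] := T_lrl.
have hk := T_hodge T_basis k.
apply: (period_int hk).1; apply/(TZ _ hk); exists (fun i => (i == k)%:Z).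
rewrite (bigD1 k)//= eqxx scale1r big1 ?addr0// => i /negbTE ->.
by rewrite scale0r.
Qed.

(** The exponent of [q_k] in the monomial of a curve class. *)
Definition curve_deg b k : R := cRe (period b (tnth T k)).

Lemma curve_degE b k : ofR (curve_deg b k) = period b (tnth T k).
Proof.
apply: ofR_cRe; have [m ->] := period_int_T b k.
have -> : (m%:~R : C) = ofR (m%:~R) by rewrite -[RHS]/(real_complex R _) rmorph_int.
by [].
Qed.

Lemma pairing_period b u : pairing curve_deg b u = period b (omega T u).
Proof.
rewrite /pairing /omega linear_sum; apply: eq_bigr => k _.
by rewrite curve_degE linearZ.
Qed.

Definition gw_coef b : C := if b == 0 then 0 else ratr (gw b).

Lemma gw_termE u b : gw_term T u b = gw_coef b * exp_term curve_deg b u.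
Proof.
rewrite /gw_term /gw_coef; case: eqP => _; first by rewrite mul0r.
by rewrite exp_termE pairing_period.
Qed.

Lemma kahler_positive (x : 'I_n -> R) : (forall k, 0 < x k) ->
  @kahler R X (\sum_k ofR (x k) *: tnth T k).
Proof.
move=> x0; have [_ intK _] := T_lrl; pose v : 'rV[R]_n := \row_k x k.
have : in_coords T (@kahler R X) v.
  apply: intK; apply/nbhs_ballP; exists (\big[Num.min/1]_k x k).
    by rewrite /=; elim/big_ind : _ => // a b a0 b0; rewrite lt_min a0 b0.
  move=> w [_ vw] k; have := vw 0 k; rewrite /ball /= mxE => h.
  have : \big[Num.min/1]_i x i <= x k by exact: bigmin_le_cond.
  by move: h; rewrite ltr_norml => /andP[_ h1] h2; lra.
by rewrite /in_coords /=; under eq_bigr do rewrite mxE.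
Qed.

Lemma curve_deg_positive b (x : 'I_n -> R) : gw_coef b != 0 -> (forall k, 0 < x k) ->
  0 < \sum_k x k * curve_deg b k.
Proof.
rewrite /gw_coef; case: (eqVneq b 0) => [|b0]; first by rewrite eqxx.
move=> g0 x0; have gw0 : gw b != 0.
  by apply: contraNneq g0 => ->; rewrite rmorph0.
rewrite -ofR_lt ofR0 ofR_sum; have := gw_effective b0 gw0 (kahler_positive x0).
rewrite linear_sum; congr (_ < _); apply: eq_bigr => k _.
by rewrite linearZ /= ofRM curve_degE.
Qed.

(** If an exponent were negative, some Kahler class with a large [T_k]-coordinate
    would have area [0] on the curve. *)
Lemma gw_coef_effective : effective curve_deg gw_coef.
Proof.
move=> b gb k; rewrite leNgt; apply/negP => d0.
have t0 : 0 < \sum_i 1 * curve_deg b i by apply: curve_deg_positive.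
(* For this [t], the class [sum_i T_i + t T_k] has area [0]. *)
pose t := (\sum_i 1 * curve_deg b i) / - curve_deg b k.
have tp : 0 <= t by rewrite divr_ge0 ?(ltW t0)// oppr_ge0 ltW.
have := @curve_deg_positive b (fun i => 1 + t * (i == k)%:R) gb.
have -> : \sum_i (1 + t * (i == k)%:R) * curve_deg b i =
    \sum_i 1 * curve_deg b i + t * curve_deg b k.
  under eq_bigr do rewrite mulrDl.
  rewrite big_split /=; congr (_ + _); rewrite (bigD1 k)//= eqxx mulr1 big1 ?addr0// => i.
  by move=> /negbTE ->; rewrite mulr0 mul0r.
have -> : t * curve_deg b k = - \sum_i 1 * curve_deg b i.
  by rewrite /t invrN mulrN mulNr divfK// ltr0_neq0.
rewrite subrr ltxx => h; suff : false by []; apply: h => i.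
by rewrite ltr_wpDr// mulr_ge0.
Qed.

(** The degree is a positive integer, being the area for the Kahler class
    [sum_k T_k]. *)
Lemma gw_total_degree b : gw_coef b != 0 -> 1 <= total_degree curve_deg b.
Proof.
move=> gb; have : 0 < \sum_k 1 * curve_deg b k by apply: curve_deg_positive.
under eq_bigr do rewrite mul1r.
have [m e] : exists m : int, \sum_k curve_deg b k = m%:~R.
  elim: (index_enum _) => [|k s [m IH]]; first by exists 0; rewrite big_nil.
  have [p hp] := period_int_T b k; exists (p + m).
  rewrite big_cons IH intrD; congr (_ + _); apply: (@ofR_inj R).
  by rewrite curve_degE hp -[RHS]/(real_complex R _) rmorph_int.
by rewrite /total_degree e ltr0z ler1z.
Qed.

Lemma gw_coef_convergent : abs_convergent curve_deg gw_coef.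
Proof.
move=> u hu; have [M hM] := summable_bounded_sums (gw_conv hu).
by exists M => A; under eq_bigr do rewrite -gw_termE; exact: hM.
Qed.

(** The effect of [q_k d/dq_k] on coefficients. *)
Definition degM k (c : curves X -> C) b : C := ofR (curve_deg b k) * c b.

(** The properties of the coefficients that are preserved by [q_k d/dq_k]. *)
Definition gw_like (c : curves X -> C) : Prop :=
  [/\ effective curve_deg c, abs_convergent curve_deg c &
     forall b, c b != 0 -> 1 <= total_degree curve_deg b].

Lemma gw_like_coef : gw_like gw_coef.
Proof. by split; [exact: gw_coef_effective|exact: gw_coef_convergent|exact: gw_total_degree]. Qed.

Lemma gw_like_degM k c : gw_like c -> gw_like (degM k c).
Proof.
move=> [e a t]; split; [exact: effectiveM|exact: deg_abs_convergent|].
by move=> b; rewrite mulf_eq0 negb_or => /andP[_ /t].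
Qed.

Lemma series_partials c u : gw_like c -> upper_half u ->
  scalar_partials (exp_series curve_deg c) u
    (fun j => twopii R * exp_series curve_deg (degM j c) u).
Proof.
move=> [e a _] hu; have [df dE] := exp_series_diff e a hu; split=> // j.
by rewrite deriveE// dE linform_delta.
Qed.

Lemma twopii_neq0 : twopii R != 0.
Proof.
apply/negP => /eqP/(congr1 (@cIm R)) /=; apply/eqP; rewrite mulf_neq0//.
by rewrite gt_eqF// pi_gt0.
Qed.

(** Each [d/du_k] is [2 pi i q_k d/dq_k], which cancels the powers of [2 pi i]
    one by one. *)
Definition hol0 u : C := (twopii R ^+ 3)^-1 * exp_series curve_deg gw_coef u.
Definition hol1 k u : C := (twopii R ^+ 2)^-1 * exp_series curve_deg (degM k gw_coef) u.
Definition hol2 k l u : C :=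
  (twopii R)^-1 * exp_series curve_deg (degM k (degM l gw_coef)) u.
Definition hol3 j k l u : C :=
  exp_series curve_deg (degM j (degM k (degM l gw_coef))) u.

Lemma Phi_holE : Phi_hol T = hol0.
Proof.
apply/funext => u; rewrite /Phi_hol /hol0 /exp_series.
by rewrite (funext (gw_termE u)).
Qed.

Lemma hol0_partials u : upper_half u -> scalar_partials hol0 u (fun j => hol1 j u).
Proof.
move=> hu; apply: scalar_partials_eq (scalar_partialsZ _ (series_partials gw_like_coef hu)) => j.
by rewrite /hol1; field; exact: twopii_neq0.
Qed.

Lemma hol1_partials k u : upper_half u -> scalar_partials (hol1 k) u (fun j => hol2 j k u).
Proof.
move=> hu; apply: scalar_partials_eq (scalar_partialsZ _
  (series_partials (gw_like_degM k gw_like_coef) hu)) => j.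
by rewrite /hol2; field; exact: twopii_neq0.
Qed.

Lemma hol2_partials k l u : upper_half u ->
  scalar_partials (hol2 k l) u (fun j => hol3 j k l u).
Proof.
move=> hu; apply: scalar_partials_eq (scalar_partialsZ _
  (series_partials (gw_like_degM k (gw_like_degM l gw_like_coef)) hu)) => j.
by rewrite /hol3 mulKf// twopii_neq0.
Qed.

Lemma hol2_sym k l u : hol2 k l u = hol2 l k u.
Proof.
rewrite /hol2 (_ : degM k (degM l gw_coef) = degM l (degM k gw_coef))//.
by apply/funext => b; rewrite /degM mulrCA.
Qed.

Lemma series_periodic c j u :
  exp_series curve_deg c (u + delta_mx 0 j) = exp_series curve_deg c u.
Proof. by apply: exp_series_periodic => b _; rewrite curve_degE; exact: period_int_T. Qed.

Lemma hol0_periodic j u : hol0 (u + delta_mx 0 j) = hol0 u.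
Proof. by rewrite /hol0 series_periodic. Qed.

Lemma hol1_periodic k j u : hol1 k (u + delta_mx 0 j) = hol1 k u.
Proof. by rewrite /hol1 series_periodic. Qed.

Lemma hol2_periodic k l j u : hol2 k l (u + delta_mx 0 j) = hol2 k l u.
Proof. by rewrite /hol2 series_periodic. Qed.

Lemma series_vanishes (x : C) c : gw_like c ->
  vanishes (fun u => x * exp_series curve_deg c u).
Proof.
move=> [e a t]; apply: vanishes_exp_bound => u hu.
have [M hM] := exp_series_decay a t hu; exists (nm x * M) => s s0.
by rewrite nmM -mulrA ler_wpM2l ?nm_ge0// hM.
Qed.

Lemma cubic_partials u : scalar_partials
  (fun v => 6%:R^-1 * integral_X X (omega T v ^+ 3) : C) u
  (fun l => 2%:R^-1 * integral_X X (tnth T l * omega T u ^+ 2)).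
Proof.
have w := omega_partials T u; have w3 := has_partialsM w (has_partialsM w w).
have hI : scalar (integral_X X) by move=> c a b; rewrite linearP.
have := scalar_partialsZ (6%:R^-1) (w3 _ hI).
apply: scalar_partials_eq => l /=; set t := tnth T l; set v := omega T u.
have -> : t * (v * v) + v * (t * v + v * t) = 3%:R *: (t * v ^+ 2).
  have vt : v * t = t * v := cup_comm _ _.
  rewrite vt -mulr2n -scaler_nat -scalerAr [v * (_ * _)]mulrA vt -mulrA -expr2.
  by rewrite -{1}[t * _]scale1r -scalerDl.
by rewrite linearZ /= mulrA; congr (_ * _); field.
Qed.

Lemma quadratic_partials l u : scalar_partials
  (fun v => 2%:R^-1 * integral_X X (tnth T l * omega T v ^+ 2) : C) u
  (fun k => integral_X X (tnth T k * tnth T l * omega T u)).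
Proof.
have w := omega_partials T u; have w2 := has_partialsM w w.
have hI : scalar (fun x => integral_X X (tnth T l * x)).
  by move=> c a b; rewrite mulrDr -scalerAr linearP.
have := scalar_partialsZ (2%:R^-1) (w2 _ hI).
apply: scalar_partials_eq => k /=; set t := tnth T k; set v := omega T u.
have -> : t * v + v * t = 2%:R *: (t * v).
  by rewrite (cup_comm v t) scaler_nat mulr2n.
rewrite -scalerAr linearZ /= mulrA mulVf ?pnatr_eq0// mul1r mulrA.
by rewrite (cup_comm (tnth T l) t).
Qed.

Lemma linear_partials k l u : scalar_partials
  (fun v => integral_X X (tnth T k * tnth T l * omega T v) : C) u
  (fun j => kappa T j k l).
Proof.
have w := omega_partials T u.
have hI : scalar (fun x => integral_X X (tnth T k * tnth T l * x)).
  by move=> c a b; rewrite mulrDr -scalerAr linearP.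
apply: scalar_partials_eq (w _ hI) => j /=.
by rewrite /kappa -[in RHS]mulrA (cup_comm (tnth T j)).
Qed.

Lemma derive_upper_half (phi psi : 'rV[C]_n -> C) v u : upper_half u ->
  (forall w, upper_half w -> phi w = psi w) -> 'D_v phi u = 'D_v psi u.
Proof.
move=> hu h; apply: near_eq_derive; near=> w; apply: h.
by near: w; exact: (open_nbhs_nbhs (conj open_upper_half hu)).
Unshelve. all: by end_near. Qed.

Lemma dPhi3_hol3 j k l u : upper_half u ->
  dPhi3 T j k l u = kappa T j k l + hol3 j k l u.
Proof.
move=> hu; have PhiE : Phi T =
    fun v => 6%:R^-1 * integral_X X (omega T v ^+ 3) + hol0 v.
  by apply/funext => v; rewrite /Phi Phi_holE.
have D1 w : upper_half w -> 'D_(delta_mx 0 l) (Phi T) w =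
    2%:R^-1 * integral_X X (tnth T l * omega T w ^+ 2) + hol1 l w.
  move=> hw; rewrite PhiE.
  by have [_ /(_ l) <-] := scalar_partialsD (cubic_partials w) (hol0_partials hw).
have D2 w : upper_half w ->
    'D_(delta_mx 0 k) (fun u2 : 'rV[C]_n => 'D_(delta_mx 0 l) (Phi T) u2) w =
    integral_X X (tnth T k * tnth T l * omega T w) + hol2 k l w.
  move=> hw; rewrite (derive_upper_half _ hw D1).
  by have [_ /(_ k) <-] := scalar_partialsD (quadratic_partials l w) (hol1_partials l hw).
rewrite /dPhi3 (derive_upper_half _ hu D2).
by have [_ /(_ j) <-] := scalar_partialsD (linear_partials k l u) (hol2_partials k l hu).
Qed.

End Potential.

Unset Implicit Arguments.
Set Strict Implicit.
Set Printing Implicit Defensive.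

Theorem theorem7p14 (R : realType) (X : cy3 R) (n : nat) (T D : n.-tuple X)
    (N : 'I_n -> 'rV[cplx R]_n -> 'End(coh X))
    (U : set 'rV[cplx R]_n) (Gamma : 'rV[cplx R]_n -> 'End(coh X))
    (hT : large_radius_limit T)
    (hD : is_dual_basis T D)
    (hconv : gw_convergent T)
    (hN : is_monodromy_log T D N)
    (hUopen : open U) (hU0 : U 0) (hUsub : U `<=` @polydisc R n)
    (hGamma : is_Gamma T D N U Gamma) :
  forall (alpha : coh X) (j : 'I_n) (u : 'rV[cplx R]_n),
    upper_half u -> U (qmap u) ->
    higgs_field N Gamma u (delta_mx 0 j) alpha
      = qprod T D u (tnth T j) alpha.
Proof.
move=> alpha j u hu hU; have [[T_basis _] _ _] := hT.
have like1 k := gw_like_degM k (gw_like_coef hT hconv).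
have like2 k l := gw_like_degM k (like1 l).
exact: (higgs_fieldE j T_basis hD
  (hol0_partials hT hconv) (hol1_partials hT hconv) (hol2_partials hT hconv)
  (hol2_sym T) (hol0_periodic hT) (hol1_periodic hT) (hol2_periodic hT)
  (series_vanishes _ (gw_like_coef hT hconv))
  (fun k => series_vanishes _ (like1 k)) (fun k l => series_vanishes _ (like2 k l))
  (dPhi3_hol3 hT hconv) hN hUopen hGamma j alpha hu hU).
Qed.
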